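(* (i) For $k\ge2$ and $l\ge1$, the element $Y_{\mathbb{N}\rightarrow\rho_{k,l+1}}\in{\mathsf{SF}}$ is denotable in ${\mathrm{PCF}}_{k,l+2}$ but not in ${\mathrm{PCF}}^\Omega_{k,l}$. (ii) For $k\ge2$, the element $Y_{\overline{k+1}}\in{\mathsf{SF}}$ is not denotable in ${\mathrm{PCF}}^\Omega_k$.
   Context: Types $\sigma::=\mathbb{N}\mid\sigma\rightarrow\sigma$; level ${\mathrm{lv}}(\mathbb{N})=0$, ${\mathrm{lv}}(\sigma\rightarrow\tau)=\max({\mathrm{lv}}\,\sigma+1,{\mathrm{lv}}\,\tau)$; pure types $\overline0=\mathbb{N}$, $\overline{k+1}=\overline k\rightarrow\mathbb{N}$. Width: $w(\mathbb{N})=0$, $w(\sigma_0,\ldots,\sigma_{r-1}\rightarrow\mathbb{N})=\max(r,w(\sigma_0),\ldots,w(\sigma_{r-1}))$. For $k,l\ge1$, $\sigma$ has sublevel $(k,l)$ if ${\mathrm{lv}}(\sigma)=k$ and $w(\sigma)=l$; $\mathbb{N}$ has sublevel $0$ (lowest); $(k,l)<(k',l')$ iff $k<k'$ or ($k=k'$ and $l<l'$). $\rho_{0,l}=\mathbb{N}$, $\rho_{k+1,l}=\rho_{k,l},\ldots,\rho_{k,l}\rightarrow\mathbb{N}$ ($l$ arguments). ${\mathrm{PCF}}$: simply typed $\lambda$-calculus over $\mathbb{N}$ with constants $\underline n,\mathit{suc},\mathit{pre},\mathit{ifzero}$ and $Y_\sigma:(\sigma\rightarrow\sigma)\rightarrow\sigma$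 (with $Y_\sigma M\rightsquigarrow M(Y_\sigma M)$), call-by-name; ${\mathrm{PCF}}^\Omega$ adds $C_f:\mathbb{N}\rightarrow\mathbb{N}$ for each partial $f:\mathbb{N}\rightharpoonup\mathbb{N}$. ${\mathrm{PCF}}_{k,l}$ (resp. ${\mathrm{PCF}}^\Omega_{k,l}$) admits $Y_\sigma$ only for $\sigma$ of sublevel $\le(k,l)$; ${\mathrm{PCF}}^\Omega_k$ admits $Y_\sigma$ only for ${\mathrm{lv}}(\sigma)\le k$. ${\mathsf{SF}}(\sigma)$ is the set of closed ${\mathrm{PCF}}^\Omega$ terms of type $\sigma$ modulo observational equivalence ($M\simeq M'$ iff for all closed contexts $C[-]:\mathbb{N}$ and all $n$, $C[M]$ reduces to $\underline n$ iff $C[M']$ does), with application induced by term application; $Y_\sigma\in{\mathsf{SF}}$ is the class of the constant $Y_\sigma$. An element is denotable in a sublanguage if it is the class of some closed term of that sublanguage. *)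

(* Defs.v *)
From Stdlib Require Import Arith List.
Import ListNotations.

Inductive ty : Type :=
| N : ty
| Arr : ty -> ty -> ty.

Fixpoint lv (t : ty) : nat :=
  match t with
  | N => 0
  | Arr s u => Nat.max (S (lv s)) (lv u)
  end.

(** For t = s_0,...,s_{r-1} -> N, [wa t] = (r, max_i w(s_i)). *)
Fixpoint wa (t : ty) : nat * nat :=
  match t with
  | N => (0, 0)
  | Arr s u =>
      (S (fst (wa u)),
       Nat.max (Nat.max (fst (wa s)) (snd (wa s))) (snd (wa u)))
  end.

(** width: w(N) = 0, w(s_0..s_{r-1} -> N) = max(r, w s_0, ..., w s_{r-1}) *)
Definition width (t : ty) : nat := Nat.max (fst (wa t)) (snd (wa t)).

(** sigma has sublevel <= (k,l): N has the lowest sublevel 0; otherwise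
    sigma has sublevel (lv sigma, width sigma), ordered lexicographically. *)
Definition sublevel_le (s : ty) (k l : nat) : Prop :=
  s = N \/ lv s < k \/ (lv s = k /\ width s <= l).

Fixpoint arrn (n : nat) (a b : ty) : ty :=
  match n with
  | 0 => b
  | S n' => Arr a (arrn n' a b)
  end.

Fixpoint rho (k l : nat) : ty :=
  match k with
  | 0 => N
  | S k' => arrn l (rho k' l) N
  end.

Fixpoint pure (k : nat) : ty :=
  match k with
  | 0 => N
  | S k' => Arr (pure k') N
  end.

Inductive tm : Type :=
| Var : nat -> tm
| Lam : ty -> tm -> tm
| App : tm -> tm -> tm
| Num : nat -> tm
| Suc : tm
| Pre : tm
| Ifz : tm
| Yc : ty -> tm
| Cf : (nat -> option nat) -> tm.

Inductive has_type : list ty -> tm -> ty -> Prop :=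
| T_Var : forall G n T, nth_error G n = Some T -> has_type G (Var n) T
| T_Lam : forall G s b T, has_type (s :: G) b T -> has_type G (Lam s b) (Arr s T)
| T_App : forall G a b s T, has_type G a (Arr s T) -> has_type G b s ->
    has_type G (App a b) T
| T_Num : forall G n, has_type G (Num n) N
| T_Suc : forall G, has_type G Suc (Arr N N)
| T_Pre : forall G, has_type G Pre (Arr N N)
| T_Ifz : forall G, has_type G Ifz (Arr N (Arr N (Arr N N)))
| T_Y : forall G s, has_type G (Yc s) (Arr (Arr s s) s)
| T_Cf : forall G f, has_type G (Cf f) (Arr N N).

Fixpoint lift (c : nat) (t : tm) : tm :=
  match t with
  | Var n => if n <? c then Var n else Var (S n)
  | Lam s b => Lam s (lift (S c) b)
  | App a b => App (lift c a) (lift c b)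
  | x => x
  end.

Fixpoint subst (k : nat) (u : tm) (t : tm) : tm :=
  match t with
  | Var n => if n =? k then u else if n <? k then Var n else Var (pred n)
  | Lam s b => Lam s (subst (S k) (lift 0 u) b)
  | App a b => App (subst k u a) (subst k u b)
  | x => x
  end.

Inductive step : tm -> tm -> Prop :=
| S_Beta : forall s b a, step (App (Lam s b) a) (subst 0 a b)
| S_Suc : forall n, step (App Suc (Num n)) (Num (S n))
| S_Pre : forall n, step (App Pre (Num n)) (Num (pred n))
| S_Ifz0 : forall x y, step (App (App (App Ifz (Num 0)) x) y) x
| S_IfzS : forall n x y, step (App (App (App Ifz (Num (S n))) x) y) y
| S_Y : forall s m, step (App (Yc s) m) (App m (App (Yc s) m))
| S_Cf : forall f n m, f n = Some m -> step (App (Cf f) (Num n)) (Num m)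
| S_AppL : forall a a' b, step a a' -> step (App a b) (App a' b)
| S_SucA : forall a a', step a a' -> step (App Suc a) (App Suc a')
| S_PreA : forall a a', step a a' -> step (App Pre a) (App Pre a')
| S_IfzA : forall a a', step a a' -> step (App Ifz a) (App Ifz a')
| S_CfA : forall f a a', step a a' -> step (App (Cf f) a) (App (Cf f) a').

Inductive steps : tm -> tm -> Prop :=
| steps_refl : forall t, steps t t
| steps_step : forall t t' t'', step t t' -> steps t' t'' -> steps t t''.

(** * Observational equivalence at type sigma.
    A closed context C[-] : N with a hole of type sigma is represented by a
    term C with [has_type [sigma] C N] (the hole is the free variable 0);
    for closed M, C[M] is [subst 0 M C]. *)
Definition obs_equiv (sigma : ty) (M M' : tm) : Prop :=
  forall C, has_type [sigma] C N ->
    forall n, steps (subst 0 M C) (Num n) <-> steps (subst 0 M' C) (Num n).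

Fixpoint Y_ok (P : ty -> Prop) (t : tm) : Prop :=
  match t with
  | Lam _ b => Y_ok P b
  | App a b => Y_ok P a /\ Y_ok P b
  | Yc s => P s
  | _ => True
  end.

Fixpoint no_oracle (t : tm) : Prop :=
  match t with
  | Lam _ b => no_oracle b
  | App a b => no_oracle a /\ no_oracle b
  | Cf _ => False
  | _ => True
  end.

Definition in_PCF_kl (k l : nat) (t : tm) : Prop :=
  no_oracle t /\ Y_ok (fun s => sublevel_le s k l) t.

Definition in_PCFO_kl (k l : nat) (t : tm) : Prop :=
  Y_ok (fun s => sublevel_le s k l) t.

Definition in_PCFO_k (k : nat) (t : tm) : Prop :=
  Y_ok (fun s => lv s <= k) t.

(** The element [Y_sigma] of SF (class of the constant Y_sigma) is denotable
    in the sublanguage L: some closed L-term is observationally equivalent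
    to Y_sigma. *)
Definition Y_denotable_in (L : tm -> Prop) (sigma : ty) : Prop :=
  exists M, L M /\ has_type [] M (Arr (Arr sigma sigma) sigma) /\
    obs_equiv (Arr (Arr sigma sigma) sigma) M (Yc sigma).

(* Main.v *)
(** Terms are interpreted in the full type structure over the partial natural numbers, [Y] being
    approximated by its finite iterates; a program has value [n] iff some approximation does.

    Suppose that [Y] at [sigma = N -> rho k (l+1)] is definable from recursors of sublevel at
    most [(k,l)], and apply it to a functional, the [chain], in which a table [w] of secrets is
    hidden. At level [m] the chain returns the answer [w 0 0], provided that its arguments pass a
    test built from row [m] of [w] and that level [m+1], called with arguments ([key]s) passing
    the next test, gives the right answer; it stops at level [d]. Its fixed point yields [w 0 0]
    at level [0].

    Now consider families of elements indexed by [w]. A functional of sublevel at most [(k-1,l)]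
    has at most [l] arguments at the lowest level, while the secret position ranges over [l+1]
    values, so by the pigeonhole principle it cannot convey how to pass the test of a level:
    this is propagated upwards through the types by a tower of logical relations. Consequently
    the recursors of sublevel at most [(k,l)] do not help to descend the chain, and every
    descent is due to the term itself, which goes down at most [m] levels with [m] independent
    of [d]. If [d > m], a result that is defined for all [w] does not depend on [w], whereas
    [w 0 0] does.

    For the pure types, a given term uses recursors of bounded width [l] only, and
    [N -> rho k (l+1)] is a definable retract of the pure type of level [k+1]. *)

From Stdlib Require Import Arith Bool List Lia Classical FunctionalExtensionality.
From Stdlib Require Import Program.Equality.
Require Import Defs.
Import ListNotations.

(** * Denotations in the full type structure over the partial naturals *)

Fixpoint D (T : ty) : Type :=
  match T with N => option nat | Arr s u => D s -> D u end.

Fixpoint bot (T : ty) : D T :=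
  match T with N => None | Arr s u => fun _ => bot u end.

Fixpoint env (G : list ty) : Type :=
  match G with [] => unit | T :: G' => (D T * env G')%type end.

Definition obind (x : option nat) (k : nat -> option nat) : option nat :=
  match x with Some n => k n | None => None end.

Inductive look : forall G, nat -> forall T, (env G -> D T) -> Prop :=
| look_0 : forall G T, look (T :: G) 0 T (fun g => fst g)
| look_S : forall G s n T p, look G n T p -> look (s :: G) (S n) T (fun g => p (snd g)).

(* The recursor is interpreted by its [i]-th iterate, [i] being the first argument of the
   denotation. *)
Inductive den : forall G, tm -> forall T, (nat -> env G -> D T) -> Prop :=
| den_Var : forall G n T p, look G n T p -> den G (Var n) T (fun _ => p)
| den_Lam : forall G s b T f, den (s :: G) b T f ->
    den G (Lam s b) (Arr s T) (fun i g a => f i (a, g))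
| den_App : forall G a b s T f x, den G a (Arr s T) f -> den G b s x ->
    den G (App a b) T (fun i g => f i g (x i g))
| den_Num : forall G n, den G (Num n) N (fun _ _ => Some n)
| den_Suc : forall G, den G Suc (Arr N N) (fun _ _ x => obind x (fun n => Some (S n)))
| den_Pre : forall G, den G Pre (Arr N N) (fun _ _ x => obind x (fun n => Some (pred n)))
| den_Ifz : forall G, den G Ifz (Arr N (Arr N (Arr N N)))
    (fun _ _ x y z => obind x (fun n => match n with 0 => y | S _ => z end))
| den_Y : forall G s, den G (Yc s) (Arr (Arr s s) s) (fun i _ F => Nat.iter i F (bot s))
| den_Cf : forall G f, den G (Cf f) (Arr N N) (fun _ _ x => obind x f).

Lemma look_exists G n T : nth_error G n = Some T -> exists p, look G n T p.
Proof.
  revert n; induction G as [|s G IH]; intros [|n] H; simpl in H; try discriminate.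
  - injection H as ->. eexists; constructor.
  - destruct (IH _ H) as [p Hp]. eexists; constructor; eassumption.
Qed.

Lemma den_exists G t T : has_type G t T -> exists f, den G t T f.
Proof.
  induction 1; try (eexists; constructor; fail).
  - destruct (look_exists _ _ _ H) as [p Hp]. eexists; constructor; eassumption.
  - destruct IHhas_type as [f Hf]. eexists; constructor; eassumption.
  - destruct IHhas_type1 as [f Hf], IHhas_type2 as [x Hx].
    eexists; econstructor; eassumption.
Qed.

Lemma look_nth G n T p : look G n T p -> nth_error G n = Some T.
Proof. induction 1; simpl; auto. Qed.

Lemma den_has_type G t T f : den G t T f -> has_type G t T.
Proof.
  induction 1; try (constructor; fail).
  - constructor. eapply look_nth; eassumption.
  - constructor; assumption.
  - econstructor; eassumption.
Qed.

(** * Substitution *)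

Fixpoint drop_mid (G1 : list ty) (s : ty) (G2 : list ty) :
    env (G1 ++ s :: G2) -> env (G1 ++ G2) :=
  match G1 return env (G1 ++ s :: G2) -> env (G1 ++ G2) with
  | [] => fun g => snd g
  | T :: G1' => fun g => (fst g, drop_mid G1' s G2 (snd g))
  end.

Fixpoint ins_mid (G1 : list ty) (s : ty) (G2 : list ty) (d : D s) :
    env (G1 ++ G2) -> env (G1 ++ s :: G2) :=
  match G1 return env (G1 ++ G2) -> env (G1 ++ s :: G2) with
  | [] => fun g => (d, g)
  | T :: G1' => fun g => (fst g, ins_mid G1' s G2 d (snd g))
  end.

Lemma look_lift G1 s G2 n T p : look (G1 ++ G2) n T p ->
  look (G1 ++ s :: G2) (if n <? length G1 then n else S n) T
    (fun g => p (drop_mid G1 s G2 g)).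
Proof.
  revert n p; induction G1 as [|s0 G1 IH]; intros n p H; simpl in *.
  - constructor; assumption.
  - dependent destruction H; simpl.
    + exact (look_0 (G1 ++ s :: G2) s0).
    + specialize (IH _ _ H).
      replace (S n <? S (length G1)) with (n <? length G1) by reflexivity.
      destruct (n <? length G1); exact (look_S _ _ _ _ _ IH).
Qed.

Lemma den_lift t : forall G1 s G2 T f, den (G1 ++ G2) t T f ->
  den (G1 ++ s :: G2) (lift (length G1) t) T (fun i g => f i (drop_mid G1 s G2 g)).
Proof.
  induction t; intros G1 s G2 T f H; dependent destruction H; simpl;
    try (constructor; fail).
  - pose proof (look_lift G1 s G2 n T p H) as L. destruct (n <? length G1);
      exact (den_Var _ _ _ _ L).
  - specialize (IHt (t :: G1) s G2 _ _ H). exact (den_Lam _ _ _ _ _ IHt).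
  - exact (den_App _ _ _ _ _ _ _ (IHt1 _ s _ _ _ H) (IHt2 _ s _ _ _ H0)).
Qed.

(** In the third alternative [T] is [s]; quantifying over [Q] states this in Leibniz form together
    with the projection, which avoids a transport from [D s] to [D T]. *)
Lemma look_subst G1 s G2 : forall n T p, look (G1 ++ s :: G2) n T p ->
  (n < length G1 /\ exists p', look (G1 ++ G2) n T p' /\
     forall d g, p (ins_mid G1 s G2 d g) = p' g) \/
  (length G1 < n /\ exists p', look (G1 ++ G2) (pred n) T p' /\
     forall d g, p (ins_mid G1 s G2 d g) = p' g) \/
  (n = length G1 /\ forall Q : forall T, (D s -> env (G1 ++ G2) -> D T) -> Prop,
     Q s (fun d _ => d) -> Q T (fun d g => p (ins_mid G1 s G2 d g))).
Proof.
  induction G1 as [|s0 G1 IH]; intros n T p H; simpl in *.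
  - dependent destruction H.
    + right; right; split; [reflexivity|]. intros Q HQ. exact HQ.
    + right; left; split; [lia|]. eexists; split; [exact H|reflexivity].
  - dependent destruction H.
    + left; split; [lia|]. exists (fun g => fst g); split; [apply (look_0 (G1 ++ G2))|reflexivity].
    + destruct (IH _ _ _ H) as [[L [p' [Hp E]]]|[[L [p' [Hp E]]]|[L HQ]]].
      * left; split; [lia|]. exists (fun g => p' (snd g)); split.
        { exact (look_S _ s0 _ _ _ Hp). }
        { intros; simpl; apply E. }
      * right; left; split; [lia|]. exists (fun g => p' (snd g)); split.
        { simpl. destruct n; [lia|]. exact (look_S _ s0 _ _ _ Hp). }
        { intros; simpl; apply E. }
      * right; right; split; [lia|]. intros Q H0.
        apply (HQ (fun T F => Q T (fun d g => F d (snd g)))). exact H0.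
Qed.

Lemma den_subst t : forall G1 s G2 T f u x, den (G1 ++ s :: G2) t T f ->
  den (G1 ++ G2) u s x ->
  den (G1 ++ G2) (subst (length G1) u t) T (fun i g => f i (ins_mid G1 s G2 (x i g) g)).
Proof.
  induction t; intros G1 s G2 T f u x H Hu; dependent destruction H; simpl.
  - destruct (look_subst _ _ _ _ _ _ H) as [[L [p' [Hp E]]]|[[L [p' [Hp E]]]|[L HQ]]].
    + rewrite (proj2 (Nat.eqb_neq _ _)) by lia. rewrite (proj2 (Nat.ltb_lt _ _)) by lia.
      replace (fun i g => p (ins_mid G1 s G2 (x i g) g)) with (fun _ : nat => p').
      * constructor; exact Hp.
      * extensionality i; extensionality g. symmetry; apply E.
    + rewrite (proj2 (Nat.eqb_neq _ _)) by lia. rewrite (proj2 (Nat.ltb_ge _ _)) by lia.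
      replace (fun i g => p (ins_mid G1 s G2 (x i g) g)) with (fun _ : nat => p').
      * constructor; exact Hp.
      * extensionality i; extensionality g. symmetry; apply E.
    + rewrite (proj2 (Nat.eqb_eq _ _)) by lia.
      apply (HQ (fun T F => den (G1 ++ G2) u T (fun i g => F (x i g) g))). exact Hu.
  - pose proof (den_lift u [] t (G1 ++ G2) _ _ Hu) as Hu'. simpl in Hu'.
    specialize (IHt (t :: G1) s G2 _ _ _ _ H Hu'). exact (den_Lam _ _ _ _ _ IHt).
  - exact (den_App _ _ _ _ _ _ _ (IHt1 _ _ _ _ _ _ _ H Hu) (IHt2 _ _ _ _ _ _ _ H0 Hu)).
  - exact (den_Num _ _).
  - exact (den_Suc _).
  - exact (den_Pre _).
  - exact (den_Ifz _).
  - exact (den_Y _ _).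
  - exact (den_Cf _ _).
Qed.

(** * Adequacy *)

(** A logical relation, hence reflexive only at monotone elements, whereas [D] contains all
    functions. *)
Fixpoint dle (T : ty) : D T -> D T -> Prop :=
  match T with
  | N => fun x y => x = None \/ x = y
  | Arr s u => fun f g => forall a b, dle s a b -> dle u (f a) (g b)
  end.

Fixpoint dle_env (G : list ty) : env G -> env G -> Prop :=
  match G with
  | [] => fun _ _ => True
  | T :: G' => fun g h => dle T (fst g) (fst h) /\ dle_env G' (snd g) (snd h)
  end.

Lemma dle_bot T : forall d, dle T (bot T) d.
Proof. induction T; simpl; intros; auto. Qed.

Lemma dle_obind x y h k : (x = None \/ x = y) ->
  (forall n, h n = None \/ h n = k n) -> obind x h = None \/ obind x h = obind y k.
Proof. intros [->| ->] H; [left; reflexivity|]. destruct y; simpl; auto. Qed.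

Lemma den_mono G t T f : den G t T f ->
  forall i g h, dle_env G g h -> dle T (f i g) (f (S i) h).
Proof.
  induction 1; intros i g h Hgh; try (simpl; intros; auto; fail).
  - induction H; simpl in Hgh.
    + apply Hgh.
    + apply IHlook; apply Hgh.
  - simpl. intros a b' Hab. apply IHden. split; assumption.
  - apply (IHden1 i g h Hgh). apply IHden2; assumption.
  - simpl; intros. apply dle_obind; auto.
  - simpl; intros. apply dle_obind; auto.
  - simpl; intros. apply dle_obind; auto. intros [|n]; assumption.
  - intros F F' HF. induction i as [|i IH]; [apply dle_bot|].
    exact (HF _ _ IH).
  - simpl; intros. apply dle_obind; auto.
Qed.

(** The index grows by one because unfolding [Yc s] puts one more application in front of the [i]-th
    iterate; the other rules only need monotonicity in the index. *)
Lemma step_den t t' : step t t' -> forall T f, den [] t T f ->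
  exists f', den [] t' T f' /\ forall i, dle T (f' i tt) (f (S i) tt).
Proof.
  assert (M : forall t T f, den [] t T f -> forall i, dle T (f i tt) (f (S i) tt)).
  { intros t0 T f H i. apply (den_mono _ _ _ _ H); exact I. }
  induction 1; intros T fx H1.
  - dependent destruction H1. dependent destruction H1_.
    eexists; split.
    + exact (den_subst _ [] _ [] _ _ _ _ H1_ H1_0).
    + intros i. apply (den_mono _ _ _ _ H1_). split; [|exact I]. apply (M _ _ _ H1_0).
  - dependent destruction H1. dependent destruction H1_. dependent destruction H1_0.
    eexists; split; [constructor|]. simpl; auto.
  - dependent destruction H1. dependent destruction H1_. dependent destruction H1_0.
    eexists; split; [constructor|]. simpl; auto.
  - dependent destruction H1. dependent destruction H1_. dependent destruction H1_1.
    dependent destruction H1_1_1. dependent destruction H1_1_2.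
    eexists; split; [eassumption|]. intros i. apply (M _ _ _ H1_2).
  - dependent destruction H1. dependent destruction H1_. dependent destruction H1_1.
    dependent destruction H1_1_1. dependent destruction H1_1_2.
    eexists; split; [eassumption|]. intros i. apply (M _ _ _ H1_0).
  - dependent destruction H1. dependent destruction H1_.
    eexists; split.
    + eapply den_App; [eassumption|]. eapply den_App; [constructor|eassumption].
    + intros i. simpl. apply (M _ _ _ H1_0).
      generalize i at 1 3 as j; induction j as [|j IH]; [apply dle_bot|].
      exact (M _ _ _ H1_0 _ _ _ IH).
  - dependent destruction H1. dependent destruction H1_. dependent destruction H1_0.
    eexists; split; [constructor|]. simpl; intros; rewrite H; auto.
  - dependent destruction H1. destruct (IHstep _ _ H1_) as [f' [Hf L]].
    eexists; split; [eapply den_App; eassumption|]. intros i. apply L. apply (M _ _ _ H1_0).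
  - dependent destruction H1. dependent destruction H1_. destruct (IHstep _ _ H1_0) as [f' [Hf L]].
    eexists; split; [exact (den_App _ _ _ _ _ _ _ (den_Suc []) Hf)|].
    intros i. simpl. apply dle_obind; auto. apply L.
  - dependent destruction H1. dependent destruction H1_. destruct (IHstep _ _ H1_0) as [f' [Hf L]].
    eexists; split; [exact (den_App _ _ _ _ _ _ _ (den_Pre []) Hf)|].
    intros i. simpl. apply dle_obind; auto. apply L.
  - dependent destruction H1. dependent destruction H1_. destruct (IHstep _ _ H1_0) as [f' [Hf L]].
    eexists; split; [exact (den_App _ _ _ _ _ _ _ (den_Ifz []) Hf)|].
    intros i. simpl. intros. apply dle_obind; auto. { apply L. } intros [|n]; assumption.
  - dependent destruction H1. dependent destruction H1_. destruct (IHstep _ _ H1_0) as [f' [Hf L]].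
    eexists; split; [exact (den_App _ _ _ _ _ _ _ (den_Cf [] f) Hf)|].
    intros i. simpl. apply dle_obind; auto. apply L.
Qed.

Lemma steps_den t n f : steps t (Num n) -> den [] t N f -> exists i, f i tt = Some n.
Proof.
  intros H; remember (Num n) as u eqn:E; revert f; induction H; intros f Hf; subst.
  - dependent destruction Hf. exists 0; reflexivity.
  - destruct (step_den _ _ H _ _ Hf) as [f' [Hf' L]].
    destruct (IHsteps eq_refl _ Hf') as [i Hi]. exists (S i).
    destruct (L i) as [E|E]; congruence.
Qed.

Lemma den_mono_closed t n f i j : den [] t N f -> f i tt = Some n -> i <= j -> f j tt = Some n.
Proof.
  intros H E L; induction L as [|j L IH]; [exact E|].
  destruct (den_mono _ _ _ _ H j tt tt I) as [E'|E']; congruence.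
Qed.

Fixpoint bnd (k : nat) (t : tm) : Prop :=
  match t with
  | Var n => n < k
  | Lam _ b => bnd (S k) b
  | App a b => bnd k a /\ bnd k b
  | _ => True
  end.

Lemma bnd_le t : forall k k', k <= k' -> bnd k t -> bnd k' t.
Proof.
  induction t; simpl; intros k k' L H; auto; try lia.
  - apply (IHt (S k)); [lia|assumption].
  - destruct H; split; eauto.
Qed.

Lemma bnd_lift t : forall k c, bnd k t -> k <= c -> lift c t = t.
Proof.
  induction t; simpl; intros k c H L; auto.
  - rewrite (proj2 (Nat.ltb_lt _ _)) by lia. reflexivity.
  - rewrite (IHt (S k)); auto; lia.
  - destruct H. rewrite (IHt1 k), (IHt2 k); auto.
Qed.

Lemma bnd_subst t : forall k c v, bnd k t -> k <= c -> subst c v t = t.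
Proof.
  induction t; simpl; intros k c v H L; auto.
  - rewrite (proj2 (Nat.eqb_neq _ _)) by lia. rewrite (proj2 (Nat.ltb_lt _ _)) by lia. reflexivity.
  - rewrite (IHt (S k)); auto; lia.
  - destruct H. rewrite (IHt1 k), (IHt2 k); auto.
Qed.

Lemma den_bnd G t T f : den G t T f -> bnd (length G) t.
Proof.
  induction 1; simpl; auto. induction H; simpl; lia.
Qed.

(** Simultaneous substitution meant for closed terms, so that nothing is lifted under binders. *)
Fixpoint msub (k : nat) (us : list tm) (t : tm) : tm :=
  match t with
  | Var n => if n <? k then Var n else nth (n - k) us (Var n)
  | Lam s b => Lam s (msub (S k) us b)
  | App a b => App (msub k us a) (msub k us b)
  | x => x
  end.

Lemma bnd_nth us i d : Forall (bnd 0) us -> i < length us -> bnd 0 (nth i us d).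
Proof. intros H L. rewrite Forall_forall in H. apply H. apply nth_In; exact L. Qed.

Lemma bnd_msub us (Hus : Forall (bnd 0) us) t : forall k,
  bnd (k + length us) t -> bnd k (msub k us t).
Proof.
  induction t; simpl; intros k H; auto.
  - destruct (n <? k) eqn:E; simpl.
    + apply Nat.ltb_lt; exact E.
    + apply Nat.ltb_ge in E. apply (bnd_le _ 0); [lia|]. apply bnd_nth; [assumption|lia].
  - destruct H; split; auto.
Qed.

Lemma subst_msub us u (Hus : Forall (bnd 0) us) (Hu : bnd 0 u) t : forall k,
  bnd (S k + length us) t -> subst k u (msub (S k) us t) = msub k (u :: us) t.
Proof.
  induction t; intros k H; simpl; auto.
  - simpl in H. destruct (n <? S k) eqn:E.
    + apply Nat.ltb_lt in E. simpl. destruct (Nat.eqb_spec n k) as [->|NE].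
      * rewrite Nat.ltb_irrefl, Nat.sub_diag. reflexivity.
      * rewrite (proj2 (Nat.ltb_lt _ _)) by lia. reflexivity.
    + apply Nat.ltb_ge in E. rewrite (proj2 (Nat.ltb_ge _ _)) by lia.
      replace (n - k) with (S (n - S k)) by lia.
      rewrite (bnd_subst _ 0); [reflexivity| |lia]. apply bnd_nth; [assumption|lia].
  - rewrite (bnd_lift _ 0); auto with arith. rewrite IHt; [reflexivity|exact H].
  - destruct H. rewrite IHt1, IHt2; auto.
Qed.

Lemma msub_nil t : forall k, bnd k t -> msub k [] t = t.
Proof.
  induction t; simpl; intros k H; auto.
  - rewrite (proj2 (Nat.ltb_lt _ _)) by lia. reflexivity.
  - rewrite IHt; auto.
  - destruct H; rewrite IHt1, IHt2; auto.
Qed.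

(** Plotkin's computability relation between denotations and terms. *)
Fixpoint adeq (T : ty) : D T -> tm -> Prop :=
  match T with
  | N => fun d t => forall n, d = Some n -> steps t (Num n)
  | Arr s u => fun d t => forall a v, bnd 0 v -> adeq s a v -> adeq u (d a) (App t v)
  end.

Lemma adeq_exp T : forall d t t', step t t' -> adeq T d t' -> adeq T d t.
Proof.
  induction T; simpl; intros d t t' H A.
  - intros n E. econstructor; eauto.
  - intros a v Hv Ha. eapply IHT2; [apply S_AppL; eassumption|]. auto.
Qed.

Lemma adeq_bot T : forall t, adeq T (bot T) t.
Proof. induction T; simpl; intros; [discriminate|auto]. Qed.

Lemma steps_trans a b c : steps a b -> steps b c -> steps a c.
Proof. induction 1; intros; auto. econstructor; eauto. Qed.

Lemma steps_map F a b : (forall x y, step x y -> step (F x) (F y)) ->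
  steps a b -> steps (F a) (F b).
Proof. intros HF; induction 1; [constructor|econstructor; eauto]. Qed.

Fixpoint aenv (G : list ty) : env G -> list tm -> Prop :=
  match G with
  | [] => fun _ us => us = []
  | T :: G' => fun g us =>
      match us with
      | [] => False
      | u :: us' => bnd 0 u /\ adeq T (fst g) u /\ aenv G' (snd g) us'
      end
  end.

Lemma aenv_bnd G : forall g us, aenv G g us -> length us = length G /\ Forall (bnd 0) us.
Proof.
  induction G as [|T G IH]; simpl; intros g us H.
  - subst; auto.
  - destruct us as [|u us]; [contradiction|]. destruct H as [H1 [H2 H3]].
    destruct (IH _ _ H3). simpl; auto.
Qed.

Lemma look_adeq G n T p : look G n T p ->
  forall g us d, aenv G g us -> adeq T (p g) (nth n us d).
Proof.
  induction 1; intros g us d A; (destruct us as [|u us]; [contradiction|]); simpl.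
  - apply A.
  - apply IHlook; apply A.
Qed.

Lemma den_adeq G t T f : den G t T f ->
  forall i g us, aenv G g us -> adeq T (f i g) (msub 0 us t).
Proof.
  induction 1; intros i g us A.
  - simpl. rewrite Nat.sub_0_r. eapply look_adeq; eassumption.
  - simpl. intros a v Hv Ha. eapply adeq_exp; [apply S_Beta|].
    destruct (aenv_bnd _ _ _ A) as [L HB].
    rewrite subst_msub; auto.
    + apply IHden. simpl; auto.
    + apply den_bnd in H. simpl in H. rewrite L. exact H.
  - simpl. apply (IHden1 i g us A); [|apply IHden2; assumption].
    destruct (aenv_bnd _ _ _ A) as [L HB]. apply bnd_msub; [assumption|].
    apply den_bnd in H0. rewrite L. exact H0.
  - simpl; intros m E; injection E as ->; constructor.
  - simpl. intros a v Hv Ha n E. destruct a as [m|]; [|discriminate]. injection E as <-.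
    eapply steps_trans; [apply (steps_map (App Suc)); [apply S_SucA|apply Ha; reflexivity]|].
    econstructor; [apply S_Suc|constructor].
  - simpl. intros a v Hv Ha n E. destruct a as [m|]; [|discriminate]. injection E as <-.
    eapply steps_trans; [apply (steps_map (App Pre)); [apply S_PreA|apply Ha; reflexivity]|].
    econstructor; [apply S_Pre|constructor].
  - simpl. intros a v Hv Ha b v1 Hv1 Hb c v2 Hv2 Hc n E. destruct a as [m|]; [|discriminate].
    eapply steps_trans.
    + apply (steps_map (fun x => App (App (App Ifz x) v1) v2)); [|apply Ha; reflexivity].
      intros x y Hxy. apply S_AppL, S_AppL, S_IfzA; exact Hxy.
    + destruct m; simpl in E; (econstructor; [constructor|auto]).
  - simpl. intros F v Hv HF. induction i as [|i IH]; [apply adeq_bot|].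
    simpl. eapply adeq_exp; [apply S_Y|]. apply HF; [simpl; auto|exact IH].
  - simpl. intros a v Hv Ha n E. destruct a as [m|]; [|discriminate]. simpl in E.
    eapply steps_trans; [apply (steps_map (App (Cf f))); [apply S_CfA|apply Ha; reflexivity]|].
    econstructor; [apply S_Cf; exact E|constructor].
Qed.

Lemma den_steps t n f i : den [] t N f -> f i tt = Some n -> steps t (Num n).
Proof.
  intros H E. pose proof (den_adeq _ _ _ _ H i tt [] eq_refl) as A.
  rewrite msub_nil in A by (apply den_bnd in H; exact H). exact (A n E).
Qed.

(* Tables of secrets: [w 0 0] is the answer of the chain; for [n >= 1], [w n 0] is the secret
   argument position of level [n], and [w n (S i)] its secret value for functionals of type
   level [i]. *)
Definition W := nat -> nat -> nat.
Definition Fam (T : ty) : Type := W -> D T.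
Definition pred_ty : Type := forall T, Fam T -> Prop.

(** * Logical relations on families indexed by tables *)

Fixpoint LR (G : pred_ty) (P : Fam N -> Prop) (T : ty) : Fam T -> Prop :=
  match T return Fam T -> Prop with
  | N => P
  | Arr s u => fun f => forall a : Fam s, G s a -> LR G P s a -> LR G P u (fun w => f w (a w))
  end.

Definition env_in (C : pred_ty) (G : list ty) (g : W -> env G) : Prop :=
  forall n T p, look G n T p -> C T (fun w => p (g w)).

Record cls (C : pred_ty) : Prop := {
  cls_den : forall G t T f, den G t T f -> forall i (g : W -> env G),
    env_in C G g -> C T (fun w => f i (g w));
  cls_app : forall s u (f : Fam (Arr s u)) (a : Fam s), C _ f -> C _ a -> C u (fun w => f w (a w));
  cls_bot : forall T, C T (fun _ => bot T) }.

(** What the constants require at ground type: [CC_case] serves [Suc], [Pre], [Ifz] and every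
    [Cf f]. *)
Record CC (P : Fam N -> Prop) : Prop := {
  CC_none : P (fun _ => None);
  CC_some : forall n, P (fun _ => Some n);
  CC_case : forall (p : Fam N) (k : nat -> Fam N), P p -> (forall n, P (k n)) ->
    P (fun w => obind (p w) (fun n => k n w)) }.

Definition meet (A B : pred_ty) : pred_ty := fun T a => A T a /\ B T a.

Lemma env_in_cons (C : pred_ty) G s (g : W -> env G) (a : Fam s) :
  env_in C G g -> C s a -> env_in C (s :: G) (fun w => (a w, g w)).
Proof.
  intros Hg Ha n T p L. dependent destruction L.
  - exact Ha.
  - exact (Hg _ _ _ L).
Qed.

Lemma cls_iter C (HC : cls C) s (F : Fam (Arr s s)) i :
  C _ F -> C s (fun w => Nat.iter i (F w) (bot s)).
Proof.
  intros HF. induction i as [|i IH]; [apply (cls_bot _ HC)|].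
  exact (cls_app _ HC _ _ _ _ HF IH).
Qed.

Lemma LR_bot G P T : P (fun _ => None) -> LR G P T (fun _ => bot T).
Proof. intros H; induction T; simpl; auto. Qed.

(** The fundamental lemma for arguments guarded by [G]. Closure holds for the meet because the
    argument of an application has to satisfy the guard too. *)
Lemma cls_LR G P : cls G -> CC P -> cls (meet G (LR G P)).
Proof.
  intros HG HP. split.
  - intros Ga t T f H i g Hg. split.
    { apply (cls_den _ HG _ _ _ _ H). intros n T' p L. apply (Hg _ _ _ L). }
    revert i g Hg. induction H; intros i g Hg.
    + apply (Hg _ _ _ H).
    + intros a' Ga La. apply (IHden i (fun w => (a' w, g w))).
      apply env_in_cons; [assumption|split; assumption].
    + apply (IHden1 i g Hg); [|apply IHden2; assumption].
      apply (cls_den _ HG _ _ _ _ H0). intros n T' p L. apply (Hg _ _ _ L).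
    + apply (CC_some _ HP).
    + intros a _ La. apply (CC_case _ HP a (fun n _ => Some (S n)) La). intros; apply (CC_some _ HP).
    + intros a _ La. apply (CC_case _ HP a (fun n _ => Some (pred n)) La). intros; apply (CC_some _ HP).
    + intros a _ La b _ Lb c _ Lc.
      pose proof (CC_case _ HP a (fun n w => match n with 0 => b w | S _ => c w end) La) as K.
      apply K. intros [|n]; assumption.
    + intros F GF LF. simpl. induction i as [|i IH].
      * apply LR_bot, (CC_none _ HP).
      * apply LF; [|exact IH]. apply (cls_iter _ HG); exact GF.
    + intros a _ La. apply (CC_case _ HP a (fun n _ => f n) La).
      intros n. destruct (f n); [apply (CC_some _ HP)|apply (CC_none _ HP)].
  - intros s u f a [Gf Lf] [Ga La]. split; [apply (cls_app _ HG _ _ _ _ Gf Ga)|apply Lf; assumption].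
  - intros T; split; [apply (cls_bot _ HG)|apply LR_bot, (CC_none _ HP)].
Qed.

Lemma cls_true : cls (fun _ _ => True).
Proof. split; auto. Qed.

Lemma cls_all (I : Type) (J : I -> Prop) (C : I -> pred_ty) :
  (forall x, J x -> cls (C x)) -> cls (fun T a => forall x, J x -> C x T a).
Proof.
  intros H. split.
  - intros G t T f chain i g Hg x Jx. apply (cls_den _ (H x Jx) _ _ _ _ chain).
    intros n T' p L. apply (Hg _ _ _ L); assumption.
  - intros s u f a Hf Ha x Jx. apply (cls_app _ (H x Jx)); auto.
  - intros T x Jx. apply (cls_bot _ (H x Jx)).
Qed.

Lemma cls_ext A B : (forall T a, A T a <-> B T a) -> cls A -> cls B.
Proof.
  intros E H. split.
  - intros G t T f chain i g Hg. apply E. apply (cls_den _ H _ _ _ _ chain).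
    intros n T' p L. apply E, (Hg _ _ _ L).
  - intros s u f a Hf Ha. apply E. apply (cls_app _ H); apply E; assumption.
  - intros T. apply E, (cls_bot _ H).
Qed.

Lemma cls_meet A B : cls A -> cls B -> cls (meet A B).
Proof.
  intros HA HB. split.
  - intros G t T f chain i g Hg. split.
    + apply (cls_den _ HA _ _ _ _ chain). intros n T' p L. apply (Hg _ _ _ L).
    + apply (cls_den _ HB _ _ _ _ chain). intros n T' p L. apply (Hg _ _ _ L).
  - intros s u f a [Hf Hf'] [Ha Ha']. split; [apply (cls_app _ HA)|apply (cls_app _ HB)]; assumption.
  - intros T; split; [apply (cls_bot _ HA)|apply (cls_bot _ HB)].
Qed.

(** * Tuples of arguments *)

Definition scons {A} (a : A) (x : nat -> A) : nat -> A :=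
  fun j => match j with 0 => a | S j' => x j' end.

Fixpoint appn (q : nat) (a : ty) : D (arrn q a N) -> (nat -> D a) -> D N :=
  match q with
  | 0 => fun f _ => f
  | S q' => fun f x => appn q' a (f (x 0)) (fun j => x (S j))
  end.

(** Tuples are infinite sequences of which the first [q] entries count; [F] sees [bot] at the
    others. *)
Fixpoint lamn (q : nat) (a : ty) (F : (nat -> D a) -> D N) : D (arrn q a N) :=
  match q with
  | 0 => F (fun _ => bot a)
  | S q' => fun x0 => lamn q' a (fun x => F (scons x0 x))
  end.

Definition pad {A} (q : nat) (b : A) (x : nat -> A) : nat -> A :=
  fun j => if j <? q then x j else b.

Lemma appn_lamn q a : forall F x, appn q a (lamn q a F) x = F (pad q (bot a) x).
Proof.
  induction q as [|q IH]; intros F x; simpl.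
  - f_equal.
  - rewrite IH. f_equal. extensionality j. destruct j; reflexivity.
Qed.

Lemma lamn_ext q a : forall F F', (forall x, F (pad q (bot a) x) = F' (pad q (bot a) x)) ->
  lamn q a F = lamn q a F'.
Proof.
  induction q as [|q IH]; intros F F' H; simpl.
  - apply (H (fun _ => bot a)).
  - extensionality x0. apply IH. intros x.
    etransitivity; [|etransitivity; [exact (H (scons x0 x))|]];
      (f_equal; extensionality j; destruct j; reflexivity).
Qed.

Lemma LR_arrn_intro G P a (HG : forall T, G T (fun _ => bot T)) (HP : P (fun _ => None)) q :
  forall f : Fam (arrn q a N),
  (forall x : nat -> Fam a, (forall j, G a (x j) /\ LR G P a (x j)) ->
     P (fun w => appn q a (f w) (fun j => x j w))) ->
  LR G P (arrn q a N) f.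
Proof.
  induction q as [|q IH]; intros f H; simpl in *.
  - apply (H (fun _ _ => bot a)). intros; split; [apply HG|apply LR_bot, HP].
  - intros a0 Ga La. apply IH. intros x Hx.
    apply (H (scons a0 x)). intros [|j]; simpl; auto.
Qed.

Lemma LR_arrn_elim G P a q : forall f : Fam (arrn q a N), LR G P (arrn q a N) f ->
  forall x : nat -> Fam a, (forall j, j < q -> G a (x j) /\ LR G P a (x j)) ->
  P (fun w => appn q a (f w) (fun j => x j w)).
Proof.
  induction q as [|q IH]; intros f H x Hx; simpl in *; [exact H|].
  apply (IH (fun w => f w (x 0 w)) ).
  - apply H; apply Hx; lia.
  - intros j L. apply (Hx (S j)); lia.
Qed.

Fixpoint outs (c : W -> nat) (T : ty) : Fam T -> Prop :=
  match T return Fam T -> Prop with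
  | N => fun p => forall w, p w = None \/ p w = Some (c w)
  | Arr s u => fun f => forall a : Fam s, outs c u (fun w => f w (a w))
  end.

Lemma LR_outs G P c (HP : forall p : Fam N, (forall w, p w = None \/ p w = Some (c w)) -> P p) T :
  forall f, outs c T f -> LR G P T f.
Proof. induction T; simpl; intros f H; auto. Qed.

Lemma outs_arrn c a q : forall f : Fam (arrn q a N),
  (forall x w, appn q a (f w) x = None \/ appn q a (f w) x = Some (c w)) -> outs c _ f.
Proof.
  induction q as [|q IH]; intros f H; simpl in *.
  - intros w. apply (H (fun _ => bot a)).
  - intros a0. apply IH. intros x w. apply (H (scons (a0 w) x)).
Qed.

(** * Ground predicates and the tower of relations *)

Definition valid (q : nat) (w : W) : Prop := forall m c, w m c < q.

(** Only the columns [0] to [S i] of row [n] may change; [ag n 0] frees the secret position and the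
    value expected there. *)
Definition ag (n i : nat) (w w' : W) : Prop := forall m c, m <> n \/ S i < c -> w m c = w' m c.

(** Vacuous for a family that is undefined somewhere in each class; most memberships of keys rest on
    this. *)
Definition Tot (q n i : nat) (p : Fam N) : Prop :=
  forall w0, valid q w0 ->
  (forall w, valid q w -> ag n i w0 w -> p w <> None) ->
  forall w, valid q w -> ag n i w0 w -> p w = p w0.

Definition flat (q n : nat) (p : Fam N) (w0 : W) : Prop :=
  exists c, forall w, valid q w -> ag n 0 w0 w -> p w = None \/ p w = Some c.

Definition supp (q n : nat) (p : Fam N) (w0 : W) (j : nat) : Prop :=
  forall w, valid q w -> ag n 0 w0 w -> w n 0 <> j -> p w = None.

(** A form of sequentiality: a family that is not flat commits itself to one position, taken from
    [J], and is defined only where this is the secret one. *)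
Definition Struct (q n : nat) (J : W -> nat -> Prop) (p : Fam N) : Prop :=
  forall w0, valid q w0 -> flat q n p w0 \/ exists j, J w0 j /\ supp q n p w0 j.

Definition upd (w : W) (n c v : nat) : W :=
  fun m d => if (m =? n) && (d =? c) then v else w m d.

Lemma upd_eq w n c v : upd w n c v n c = v.
Proof. unfold upd. rewrite !Nat.eqb_refl. reflexivity. Qed.

Lemma upd_neq w n c v m d : m <> n \/ d <> c -> upd w n c v m d = w m d.
Proof.
  intros H. unfold upd. destruct (Nat.eqb_spec m n), (Nat.eqb_spec d c); simpl; auto.
  exfalso; tauto.
Qed.

Lemma upd_valid q w n c v : valid q w -> v < q -> valid q (upd w n c v).
Proof. intros H L m d. unfold upd. destruct ((m =? n) && (d =? c)); auto. Qed.

Lemma ag_refl n i w : ag n i w w.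
Proof. intros m c _; reflexivity. Qed.

Lemma ag_trans n i w w' w'' : ag n i w w' -> ag n i w' w'' -> ag n i w w''.
Proof. intros H H' m c L. rewrite H, H'; auto. Qed.

Lemma ag_upd n i w c v : c <= S i -> ag n i w (upd w n c v).
Proof. intros L m d H. rewrite upd_neq; [reflexivity|]. destruct H; [auto|right; lia]. Qed.

Lemma ag_le n i i' w w' : i <= i' -> ag n i w w' -> ag n i' w w'.
Proof. intros L H m c K. apply H. destruct K; [auto|right; lia]. Qed.

Lemma CC_Tot q n i : CC (Tot q n i).
Proof.
  split.
  - intros w0 V H w _ _. reflexivity.
  - intros c w0 V H w _ _. reflexivity.
  - intros p k Hp Hk w0 V H w Vw Aw.
    assert (T : forall w, valid q w -> ag n i w0 w -> p w = p w0).
    { apply Hp; [assumption|]. intros w' V' A' E. apply (H w' V' A'). rewrite E; reflexivity. }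
    rewrite (T w Vw Aw). destruct (p w0) as [c|] eqn:E; [|reflexivity]. simpl.
    apply Hk; auto. intros w' V' A' E'. apply (H w' V' A'). rewrite (T w' V' A'). exact E'.
Qed.

(** If [p] commits itself to a position, so does the composite. Otherwise [p] has at most one value
    [c] on the class, and the alternative that holds for [k c] is inherited. *)
Lemma CC_Struct q n J : CC (Struct q n J).
Proof.
  split.
  - intros w0 V. left. exists 0. auto.
  - intros c w0 V. left. exists c. auto.
  - intros p k Hp Hk w0 V. destruct (Hp w0 V) as [[c Hc]|[j [Jj Hj]]].
    + destruct (Hk c w0 V) as [[c' Hc']|[j [Jj Hj]]].
      * left. exists c'. intros w Vw Aw. destruct (Hc w Vw Aw) as [E|E]; rewrite E; simpl; auto.
      * right. exists j; split; [assumption|]. intros w Vw Aw NE.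
        destruct (Hc w Vw Aw) as [E|E]; rewrite E; simpl; auto.
    + right. exists j; split; [assumption|]. intros w Vw Aw NE. rewrite Hj; auto.
Qed.

Lemma CC_and P Q : CC P -> CC Q -> CC (fun p => P p /\ Q p).
Proof.
  intros HP HQ. split.
  - split; [apply (CC_none _ HP)|apply (CC_none _ HQ)].
  - intros n; split; [apply (CC_some _ HP)|apply (CC_some _ HQ)].
  - intros p k [H H'] K. split.
    + apply (CC_case _ HP); [assumption|apply K].
    + apply (CC_case _ HQ); [assumption|apply K].
Qed.

Lemma Tot_nontotal q n i (p : Fam N) :
  (forall w0, valid q w0 -> exists w, valid q w /\ ag n i w0 w /\ p w = None) -> Tot q n i p.
Proof.
  intros H w0 V K. destruct (H w0 V) as [w [Vw [Aw E]]]. elim (K w Vw Aw E).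
Qed.

Lemma Tot_out q n i c (p : Fam N) : (forall w w', ag n i w w' -> c w = c w') ->
  (forall w, p w = None \/ p w = Some (c w)) -> Tot q n i p.
Proof.
  intros Hc Hp w0 V K w Vw Aw.
  destruct (Hp w) as [E|E]; [elim (K w Vw Aw E)|].
  destruct (Hp w0) as [E0|E0]; [elim (K w0 V (ag_refl _ _ _) E0)|].
  rewrite E, E0, (Hc _ _ Aw). reflexivity.
Qed.

Lemma Struct_out q n J c (p : Fam N) : (forall w w', ag n 0 w w' -> c w = c w') ->
  (forall w, p w = None \/ p w = Some (c w)) -> Struct q n J p.
Proof.
  intros Hc Hp w0 V. left. exists (c w0). intros w Vw Aw. rewrite (Hc _ _ Aw). apply Hp.
Qed.

Definition ground1 (q n : nat) (J : W -> nat -> Prop) (p : Fam N) : Prop :=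
  Struct q n J p /\ Tot q n 1 p.

Definition QJ (q n : nat) (J : W -> nat -> Prop) : pred_ty :=
  LR (fun _ _ => True) (ground1 q n J).

Definition proper (q : nat) (J : W -> nat -> Prop) : Prop :=
  forall w, valid q w -> exists j, j < q /\ ~ J w j.

(** A proper [J] always misses a position, so the tuples to be handled cannot cover the secret one
    everywhere. This admits [key q n 0], which [Q1] excludes when [2 <= q]. *)
Definition G1 (q n : nat) : pred_ty := fun T a => forall J, proper q J -> QJ q n J T a.
Definition Q1 (q n : nat) : pred_ty := QJ q n (fun _ _ => True).

(* [G] collects the families that may be passed around freely, although they may know how to
   pass the test of level [n]; [Q] those that do not know it, being unable to produce the
   secret [w n (S (S i))]. *)
Fixpoint tower (q n i : nat) : pred_ty * pred_ty :=
  match i with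
  | 0 => (G1 q n, Q1 q n)
  | S i' =>
      let G := fst (tower q n i') in
      let Q := snd (tower q n i') in
      (meet (meet G Q) (LR (meet G Q) (Tot q n (S (S i')))), LR G (Tot q n (S (S i'))))
  end.

Definition Gt q n i := fst (tower q n i).
Definition Qt q n i := snd (tower q n i).

Lemma CC_ground1 q n J : CC (ground1 q n J).
Proof. apply CC_and; [apply CC_Struct|apply CC_Tot]. Qed.

Lemma cls_QJ q n J : cls (QJ q n J).
Proof.
  apply (cls_ext (meet (fun _ _ => True) (QJ q n J))).
  - intros T a. unfold meet. tauto.
  - apply cls_LR; [apply cls_true|apply CC_ground1].
Qed.

(** At successor stages [Qt] is treated jointly with [Gt], since its arguments are guarded by the
    preceding [Gt]. *)
Lemma cls_tower q n i : cls (Gt q n i) /\ cls (meet (Gt q n i) (Qt q n i)).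
Proof.
  induction i as [|i [IH1 IH2]].
  - assert (H : cls (G1 q n)).
    { apply (cls_all _ (proper q) (QJ q n)). intros J _. apply cls_QJ. }
    split; [exact H|]. apply cls_meet; [exact H|apply cls_QJ].
  - assert (H : cls (Gt q n (S i))).
    { apply cls_LR; [exact IH2|apply CC_Tot]. }
    split; [exact H|].
    pose proof (cls_meet _ _ H (cls_LR _ _ IH1 (CC_Tot q n (S (S i))))) as K.
    revert K. apply cls_ext. intros T a.
    change (Qt q n (S i)) with (LR (Gt q n i) (Tot q n (S (S i)))).
    change (Gt q n (S i)) with
      (meet (meet (Gt q n i) (Qt q n i)) (LR (meet (Gt q n i) (Qt q n i)) (Tot q n (S (S i))))).
    unfold meet. tauto.
Qed.

(** * Sublevels *)

Lemma sublevel_arg s u K l : sublevel_le (Arr s u) (S K) l -> sublevel_le s K l.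
Proof.
  unfold sublevel_le, width. cbn [lv wa fst snd]. intros [H|[H|[H H']]]; [discriminate| |].
  - right; left; lia.
  - destruct (Nat.lt_ge_cases (lv s) K) as [L|L]; [right; left; exact L|].
    right; right. split; lia.
Qed.

Lemma sublevel_tail s u K l : sublevel_le (Arr s u) K l -> sublevel_le u K l.
Proof.
  unfold sublevel_le, width. cbn [lv wa fst snd]. intros [H|[H|[H H']]]; [discriminate| |].
  - right; left; lia.
  - destruct (Nat.lt_ge_cases (lv u) K) as [L|L]; [right; left; exact L|].
    right; right. split; lia.
Qed.

Lemma sublevel_S T K l : sublevel_le T K l -> sublevel_le T (S K) l.
Proof. unfold sublevel_le. intros [H|[H|[H H']]]; auto; right; left; lia. Qed.

Lemma sublevel_1 T l : sublevel_le T 1 l -> exists a, T = arrn a N N /\ a <= l.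
Proof.
  intros H.
  assert (K : lv T <= 1).
  { destruct H as [->|[H|[H _]]]; simpl; lia. }
  assert (E : exists a, T = arrn a N N /\ a = fst (wa T)).
  { clear H. induction T as [|s IHs u IHu]; [exists 0; auto|].
    cbn [lv] in K. destruct s; [|cbn [lv] in K; lia].
    destruct IHu as [a [E E']]; [lia|]. exists (S a). simpl. split; congruence. }
  destruct E as [a [E E']]. exists a; split; [exact E|]. subst a.
  destruct H as [->|[H|[_ H]]]; simpl; [lia| |unfold width in H; lia].
  destruct T; cbn [lv wa fst snd] in *; lia.
Qed.

Lemma pigeonhole (R : nat -> nat -> Prop) a :
  (forall i j j', R i j -> R i j' -> j = j') -> exists j, j <= a /\ forall i, i < a -> ~ R i j.
Proof.
  intros U.
  assert (L : forall b, exists js, length js <= b /\ forall i j, i < b -> R i j -> In j js).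
  { induction b as [|b [js [H1 H2]]].
    - exists []; split; [auto|]. intros; lia.
    - destruct (classic (exists j, R b j)) as [[j Hj]|NE].
      + exists (j :: js). split; [simpl; lia|]. intros i j' Hi Hr.
        destruct (Nat.eq_dec i b) as [->|NE]; [left; eauto|].
        right. apply (H2 i); [lia|assumption].
      + exists js. split; [lia|]. intros i j' Hi Hr.
        destruct (Nat.eq_dec i b) as [->|NE']; [elim NE; eauto|].
        apply (H2 i); [lia|assumption]. }
  destruct (L a) as [js [H1 H2]].
  apply NNPP. intros NE.
  assert (I : incl (seq 0 (S a)) js).
  { intros j Hj. apply in_seq in Hj. apply NNPP. intros NI. apply NE.
    exists j; split; [lia|]. intros i Hi Hr. apply NI. eapply H2; eassumption. }
  pose proof (NoDup_incl_length (seq_NoDup _ _) I) as K. rewrite length_seq in K. lia.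
Qed.

(* Fewer than [q] arguments leave some position [j < q] unoccupied, hence a proper [J]. *)
Lemma G1_Q1_arrn q n a (f : Fam (arrn a N N)) :
  a < q -> G1 q n _ f -> Q1 q n (arrn a N N) f.
Proof.
  intros La Hf. apply LR_arrn_intro; [auto|apply (CC_none _ (CC_ground1 _ _ _))|].
  intros x Hx.
  set (J' := fun w j => exists i, i < a /\ ~ flat q n (x i) w /\ supp q n (x i) w j).
  assert (PJ : proper q J').
  { intros w Vw.
    destruct (pigeonhole (fun i j => i < a /\ ~ flat q n (x i) w /\ supp q n (x i) w j) a)
      as [j [Lj Hj]].
    (* With two supporting positions a family would be undefined on the whole class, hence flat; so
       each argument occupies at most one position. *)
    - intros i j j' [_ [F S]] [_ [_ S']]. apply NNPP. intros NE. apply F.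
      exists 0. intros w' V' A'. left.
      destruct (Nat.eq_dec (w' n 0) j) as [E|E]; [apply S'|apply S]; auto. congruence.
    - exists j. split; [lia|]. intros [i [Li Hi]]. apply (Hj i Li). tauto. }
  assert (K : ground1 q n J' (fun w => appn a N (f w) (fun j => x j w))).
  { apply (LR_arrn_elim _ _ _ _ _ (Hf J' PJ)). intros j Lj. split; [exact I|].
    destruct (Hx j) as [_ [S T]]. split; [|exact T].
    intros w Vw. destruct (classic (flat q n (x j) w)) as [F|F]; [left; exact F|].
    destruct (S w Vw) as [F'|[j0 [_ Hj0]]]; [contradiction|].
    right. exists j0; split; [|exact Hj0]. exists j; auto. }
  destruct K as [S T]. split; [|exact T].
  intros w Vw. destruct (S w Vw) as [F|[j [_ Hj]]]; [left; exact F|right; exists j; auto].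
Qed.

(** The arguments have sublevel at most [(K,l)], where [G] implies [Q], so both guards admit the
    same ones. An equivalence is proved because arguments occur contravariantly. *)
Lemma LR_relax (G Q : pred_ty) P K l :
  cls G ->
  (forall T a, sublevel_le T K l -> G T a -> Q T a) ->
  forall T, sublevel_le T (S K) l -> forall a, G T a -> (LR (meet G Q) P T a <-> LR G P T a).
Proof.
  intros HG H. induction T as [|s IHs u IHu]; intros HT f Gf; simpl; [tauto|].
  assert (Hs : sublevel_le s K l) by (eapply sublevel_arg; eassumption).
  assert (Hu : sublevel_le u (S K) l) by (eapply sublevel_tail; eassumption).
  assert (Hs' : sublevel_le s (S K) l) by (apply sublevel_S; exact Hs).
  split.
  - intros L a Ga La. apply IHu; [assumption|apply (cls_app _ HG _ _ _ _ Gf Ga)|].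
    apply L; [split; [|apply H]; assumption|]. apply IHs; assumption.
  - intros L a [Ga _] La. apply IHu; [assumption|apply (cls_app _ HG _ _ _ _ Gf Ga)|].
    apply L; [assumption|]. apply IHs; assumption.
Qed.

(** The width bound enters here: at the lowest stage, [l] arguments cannot occupy all [S l]
    positions. [LR_relax] carries the inclusion up the levels. *)
Lemma tower_sub l n i : forall T a, sublevel_le T (S i) l ->
  Gt (S l) n i T a -> Qt (S l) n i T a.
Proof.
  induction i as [|i IH]; intros T a HT Ha.
  - destruct (sublevel_1 _ _ HT) as [b [-> Lb]]. apply G1_Q1_arrn; [lia|exact Ha].
  - destruct Ha as [[Ga Qa] La].
    apply (LR_relax _ _ _ (S i) l (proj1 (cls_tower (S l) n i)) IH); assumption.
Qed.

(** The only possible answer does not depend on the freed entries, so the ground predicates hold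
    whatever the arguments are. *)
Lemma tower_outs q n c i :
  forall i' T f, i' <= i -> (forall w w', ag n (S i) w w' -> c w = c w') -> outs c T f ->
  Gt q n i' T f /\ Qt q n i' T f.
Proof.
  intros i' T f L Hc Ho. revert L. induction i' as [|i' IH]; intros L.
  - assert (K : forall J, QJ q n J T f).
    { intros J. apply (LR_outs _ _ c); [|assumption]. intros p Hp. split.
      - apply (Struct_out _ _ _ c); [|assumption]. intros; apply Hc. apply (ag_le n 0); [lia|assumption].
      - apply (Tot_out _ _ _ c); [|assumption]. intros; apply Hc. apply (ag_le n 1); [lia|assumption]. }
    split; [intros J _; apply K|apply K].
  - destruct IH as [IH1 IH2]; [lia|].
    assert (K : forall G, LR G (Tot q n (S (S i'))) T f).
    { intros G. apply (LR_outs _ _ c); [|assumption]. intros p Hp.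
      apply (Tot_out _ _ _ c); [|assumption]. intros; apply Hc.
      apply (ag_le n (S (S i'))); [lia|assumption]. }
    split; [split; [split; assumption|apply K]|apply K].
Qed.

(** * Keys and the chain *)

Definition chk (o : D N) (a b : nat) : D N := obind o (fun x => if x =? a then Some b else None).

(* [key n i] answers [w n (i + 2)] to an argument that behaves on [args n (i - 1)] as
   [key n (i - 1)] does; for [i = 0], to a tuple with value [w n 1] at position [w n 0]. *)
Fixpoint key (q n i : nat) (w : W) : D (rho (S i) q) :=
  match i return D (rho (S i) q) with
  | 0 => lamn q N (fun u => chk (u (w n 0)) (w n 1) (w n 2))
  | S i' => lamn q (rho (S i') q) (fun x =>
      chk (appn q (rho i' q) (x 0)
             (match i' return nat -> D (rho i' q) with
              | 0 => fun j => if j =? w n 0 then Some (w n 1) else None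
              | S i'' => fun j => match j with 0 => key q n i'' w | S _ => bot _ end
              end))
        (w n (S (S i'))) (w n (S (S (S i')))))
  end.

(** The same [match] is inlined in [key] to keep that recursion structural; [appn_keyS] folds it
    back. *)
Definition args (q n i : nat) (w : W) : nat -> D (rho i q) :=
  match i return nat -> D (rho i q) with
  | 0 => fun j => if j =? w n 0 then Some (w n 1) else None
  | S i'' => fun j => match j with 0 => key q n i'' w | S _ => bot _ end
  end.

Lemma chk_out o a b : chk o a b = None \/ chk o a b = Some b.
Proof. destruct o as [x|]; simpl; [destruct (x =? a)|]; auto. Qed.

Lemma chk_neq o a b : o <> Some a -> chk o a b = None.
Proof.
  intros H. destruct o as [x|]; simpl; [|reflexivity].
  destruct (Nat.eqb_spec x a); [congruence|reflexivity].
Qed.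

Lemma chk_eq a b : chk (Some a) a b = Some b.
Proof. simpl. rewrite Nat.eqb_refl. reflexivity. Qed.

Lemma pad_lt A q (b : A) x j : j < q -> pad q b x j = x j.
Proof. intros H. unfold pad. rewrite (proj2 (Nat.ltb_lt _ _) H). reflexivity. Qed.

Lemma appn_key0 q n w x : valid q w ->
  appn q N (key q n 0 w) x = chk (x (w n 0)) (w n 1) (w n 2).
Proof. intros V. simpl. rewrite appn_lamn, pad_lt; [reflexivity|apply V]. Qed.

Lemma appn_keyS q n i w x : 0 < q ->
  appn q (rho (S i) q) (key q n (S i) w) x =
  chk (appn q (rho i q) (x 0) (args q n i w)) (w n (S (S i))) (w n (S (S (S i)))).
Proof.
  intros H. change (key q n (S i) w) with (lamn q (rho (S i) q) (fun x =>
    chk (appn q (rho i q) (x 0) (args q n i w)) (w n (S (S i))) (w n (S (S (S i)))))).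
  rewrite appn_lamn, pad_lt by exact H. reflexivity.
Qed.

Lemma key_args q n i w : 0 < q -> valid q w ->
  appn q (rho i q) (key q n i w) (args q n i w) = Some (w n (S (S i))).
Proof.
  intros Hq V. induction i as [|i IH].
  - rewrite appn_key0 by exact V. simpl. rewrite Nat.eqb_refl. apply chk_eq.
  - rewrite appn_keyS by exact Hq. simpl args at 1. rewrite IH. apply chk_eq.
Qed.

Lemma key_outs q n i : 0 < q -> outs (fun w => w n (S (S i))) (rho (S i) q) (key q n i).
Proof.
  intros Hq. apply (outs_arrn _ (rho i q)). intros x w. destruct i as [|i].
  - simpl. rewrite appn_lamn. apply chk_out.
  - rewrite appn_keyS by exact Hq. apply chk_out.
Qed.

Lemma other_value q c : 2 <= q -> exists v, v < q /\ v <> c.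
Proof. intros H. destruct (Nat.eq_dec c 0); [exists 1|exists 0]; lia. Qed.

Definition escapes (q n i : nat) : Prop := forall x : Fam (rho (S i) q), Qt q n i _ x ->
  forall w0, valid q w0 -> exists w, valid q w /\ ag n (S i) w0 w /\
    appn q (rho i q) (x w) (args q n i w) <> Some (w n (S (S i))).

Definition key_none (q n i : nat) : Prop := forall x : nat -> Fam (rho i q),
  (forall j, Gt q n i _ (x j)) ->
  forall w0, valid q w0 -> exists w, valid q w /\ ag n i w0 w /\
    appn q (rho i q) (key q n i w) (fun j => x j w) = None.

(** If [p] always gave the secret, it would be total and so constant by [Tot]; but [ag n (S i)] lets
    this very secret change. *)
Lemma Tot_escapes q n i (p : Fam N) : 2 <= q -> Tot q n (S i) p ->
  forall w0, valid q w0 -> exists w, valid q w /\ ag n (S i) w0 w /\ p w <> Some (w n (S (S i))).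
Proof.
  intros Hq T w0 V. apply NNPP. intros H.
  assert (K : forall w, valid q w -> ag n (S i) w0 w -> p w = Some (w n (S (S i)))).
  { intros w Vw Aw. apply NNPP. intros E. apply H. exists w; auto. }
  destruct (other_value q (w0 n (S (S i))) Hq) as [v [Lv Hv]].
  pose (w := upd w0 n (S (S i)) v).
  assert (Vw : valid q w) by (apply upd_valid; assumption).
  assert (Aw : ag n (S i) w0 w) by (apply ag_upd; lia).
  assert (E : p w = p w0).
  { apply T; auto. intros w' V' A'. rewrite K; [discriminate|assumption..]. }
  rewrite K, K in E; auto using ag_refl. unfold w in E. rewrite upd_eq in E. congruence.
Qed.

(** The tuple [args q n 0] is itself an admissible argument: its component [j] is supported at
    position [j] and becomes undefined when the secret position moves away. *)
Lemma escapes_0 q n : 2 <= q -> escapes q n 0.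
Proof.
  intros Hq x Hx. apply Tot_escapes; [exact Hq|].
  apply (LR_arrn_elim _ _ _ _ _ Hx (fun j w => args q n 0 w j)).
  intros j _. split; [exact I|]. split.
  - intros w0 V. right. exists j. split; [exact I|]. intros w Vw Aw E. simpl.
    destruct (Nat.eqb_spec j (w n 0)); [congruence|reflexivity].
  - apply Tot_nontotal. intros w0 V. destruct (other_value q j Hq) as [v [Lv Hv]].
    exists (upd w0 n 0 v). split; [apply upd_valid; assumption|]. split; [apply ag_upd; lia|].
    simpl. rewrite upd_eq. destruct (Nat.eqb_spec j v); [congruence|reflexivity].
Qed.

Lemma escapes_S q n i : 2 <= q -> Gt q n i _ (key q n i) -> Qt q n (S i) _ (key q n i) ->
  escapes q n (S i).
Proof.
  intros Hq Ga Qa x Hx. apply Tot_escapes; [exact Hq|].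
  apply (LR_arrn_elim _ _ _ _ _ Hx (fun j w => args q n (S i) w j)).
  intros [|j] _; [split; assumption|].
  split; [apply (cls_bot _ (proj1 (cls_tower q n i)))|apply (LR_bot _ _ (rho (S i) q)), (CC_none _ (CC_Tot _ _ _))].
Qed.

Lemma key_none_Qt q n i : key_none q n i -> Qt q n (S i) _ (key q n i).
Proof.
  intros H. apply (LR_arrn_intro _ _ (rho i q)); [apply (cls_bot _ (proj1 (cls_tower q n i)))|
    apply (CC_none _ (CC_Tot _ _ _))|].
  intros x Hx. apply Tot_nontotal. intros w0 V.
  destruct (H x (fun j => proj1 (Hx j)) w0 V) as [w [Vw [Aw E]]].
  exists w. split; [exact Vw|]. split; [apply (ag_le n i); [lia|exact Aw]|exact E].
Qed.

(** Move the secret position to some [j] outside [J]. Component [j] is then undefined, or flat, in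
    which case the expected value [w n 1] is moved away from its value. Either way the key is
    undefined somewhere. *)
Lemma key_Gt_0 q n : 2 <= q -> Gt q n 0 _ (key q n 0).
Proof.
  intros Hq J PJ.
  apply LR_arrn_intro; [auto|apply (CC_none _ (CC_ground1 _ _ _))|].
  intros u Hu. split.
  - apply (Struct_out _ _ _ (fun w => w n 2)).
    + intros w w' A. apply A. lia.
    + intros w. simpl. rewrite appn_lamn. apply chk_out.
  - apply Tot_nontotal. intros w0 V. destruct (PJ w0 V) as [j [Lj Nj]].
    assert (E : exists w, valid q w /\ ag n 0 w0 w /\ w n 0 = j /\ u j w <> Some (w n 1)).
    { destruct (Hu j) as [_ [S _]].
      assert (V0 : valid q (upd w0 n 0 j)) by (apply upd_valid; assumption).
      destruct (S w0 V) as [[c Hc]|[j0 [Jj Hj]]].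
      - destruct (other_value q c Hq) as [v [Lv Hv]].
        assert (A : ag n 0 w0 (upd (upd w0 n 0 j) n 1 v)).
        { apply (ag_trans _ _ _ (upd w0 n 0 j)); apply ag_upd; lia. }
        exists (upd (upd w0 n 0 j) n 1 v). split; [apply upd_valid; assumption|].
        split; [exact A|]. split; [rewrite upd_neq, upd_eq; [reflexivity|lia]|].
        rewrite upd_eq. destruct (Hc _ (upd_valid _ _ n 1 v V0 Lv) A) as [E|E]; rewrite E; congruence.
      - exists (upd w0 n 0 j). split; [exact V0|]. split; [apply ag_upd; lia|].
        split; [apply upd_eq|]. rewrite Hj; [discriminate|assumption|apply ag_upd; lia|].
        rewrite upd_eq. intros ->. contradiction. }
    destruct E as [w [Vw [Aw [<- E]]]]. exists w. split; [exact Vw|].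
    split; [apply (ag_le n 0); [lia|exact Aw]|].
    rewrite (appn_key0 q n w _ Vw). apply chk_neq, E.
Qed.

Lemma key_none_0 q n : 2 <= q -> key_none q n 0.
Proof.
  intros Hq x Hx w0 V.
  (* The empty [J] leaves only the flat alternative. *)
  destruct (Hx (w0 n 0) (fun _ _ => False)) as [S _].
  { intros w _. exists 0. split; [lia|auto]. }
  destruct (S w0 V) as [[c Hc]|[j [[] _]]].
  destruct (other_value q c Hq) as [v [Lv Hv]].
  assert (V' : valid q (upd w0 n 1 v)) by (apply upd_valid; assumption).
  assert (A : ag n 0 w0 (upd w0 n 1 v)) by (apply ag_upd; lia).
  exists (upd w0 n 1 v). split; [exact V'|]. split; [exact A|].
  rewrite (appn_key0 q n _ _ V'). apply chk_neq. rewrite upd_eq, upd_neq by lia.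
  destruct (Hc _ V' A) as [E|E]; rewrite E; congruence.
Qed.

Lemma key_none_S q n i : 2 <= q -> escapes q n i -> key_none q n (S i).
Proof.
  intros Hq H x Hx w0 V. destruct (Hx 0) as [[_ Qx] _].
  destruct (H _ Qx w0 V) as [w [Vw [Aw E]]]. exists w. split; [exact Vw|]. split; [exact Aw|].
  rewrite appn_keyS by lia. apply chk_neq, E.
Qed.

Lemma key_Gt_S q n i : 2 <= q -> escapes q n i -> Gt q n (S i) _ (key q n (S i)).
Proof.
  intros Hq H. split.
  - apply (tower_outs q n (fun w => w n (S (S (S i)))) i); [lia| |apply key_outs; lia].
    intros w w' A. apply A. lia.
  - apply (LR_arrn_intro _ _ (rho (S i) q)); [apply (cls_bot _ (proj2 (cls_tower q n i)))|
      apply (CC_none _ (CC_Tot _ _ _))|].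
    intros x Hx. apply Tot_nontotal. intros w0 V.
    destruct (H (x 0) (proj2 (proj1 (Hx 0))) w0 V) as [w [Vw [Aw E]]].
    exists w. split; [exact Vw|]. split; [apply (ag_le n (S i)); [lia|exact Aw]|].
    rewrite (appn_keyS q n i w) by lia. apply chk_neq, E.
Qed.

(** The three claims feed each other: a key that guarded arguments cannot open is an admissible
    argument one stage higher, which makes [escapes] available there, and this protects the next
    key. *)
Lemma key_spec q n i : 2 <= q -> escapes q n i /\ key_none q n i /\ Gt q n i _ (key q n i).
Proof.
  intros Hq. induction i as [|i [IH1 [IH2 IH3]]].
  - split; [apply escapes_0|split; [apply key_none_0|apply key_Gt_0]]; exact Hq.
  - split; [apply escapes_S; auto using key_none_Qt|].
    split; [apply key_none_S|apply key_Gt_S]; assumption.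
Qed.

Lemma key_tower_other q n m i : 0 < q -> m <> n -> forall i', i' <= i ->
  Gt q n i' _ (key q m i) /\ Qt q n i' _ (key q m i).
Proof.
  intros Hq NE i' L. apply (tower_outs q n (fun w => w m (S (S i))) i); [exact L| |].
  - intros w w' A. apply A. auto.
  - apply key_outs, Hq.
Qed.

(* The chain of depth [d]: level [m] demands the key of level [m] (none is needed at [m = 0]) and
   the correct answer from level [m + 1], which it calls with the next key. *)
Definition chain (q k0 d : nat) (w : W) :
    D (Arr (Arr N (rho (S (S k0)) q)) (Arr N (rho (S (S k0)) q))) :=
  fun F nn => lamn q (rho (S k0) q) (fun x =>
    obind nn (fun m => if d <? m then None else
      obind (if m =? 0 then Some 0
             else chk (appn q (rho k0 q) (x 0) (args q m k0 w)) (w m (S (S k0))) 0)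
        (fun _ => if m <? d then chk (appn q (rho (S k0) q) (F (Some (S m))) (args q (S m) (S k0) w))
                                    (w 0 0) (w 0 0)
                  else Some (w 0 0)))).

Lemma appn_chain q k0 d w F m x : 0 < q ->
  appn q (rho (S k0) q) (chain q k0 d w F (Some m)) x =
  if d <? m then None else
    obind (if m =? 0 then Some 0
           else chk (appn q (rho k0 q) (x 0) (args q m k0 w)) (w m (S (S k0))) 0)
      (fun _ => if m <? d then chk (appn q (rho (S k0) q) (F (Some (S m))) (args q (S m) (S k0) w))
                                  (w 0 0) (w 0 0)
                else Some (w 0 0)).
Proof. intros Hq. unfold chain. rewrite appn_lamn, pad_lt by exact Hq. reflexivity. Qed.

(** [K] is abstract so as to cover iterates taken in another type and then retracted. From level [m]
    on, [d - m + 1] iterates are needed. *)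
Lemma chain_value q k0 d w (K : nat -> D (Arr N (rho (S (S k0)) q))) : 0 < q -> valid q w ->
  (forall j, K (S j) = chain q k0 d w (K j)) ->
  forall j m x, m <= d -> d < m + j ->
  (m = 0 \/ appn q (rho k0 q) (x 0) (args q m k0 w) = Some (w m (S (S k0)))) ->
  appn q (rho (S k0) q) (K j (Some m)) x = Some (w 0 0).
Proof.
  intros Hq V HK. induction j as [|j IH]; intros m x Lm Lj Hx; [lia|].
  rewrite HK, appn_chain by exact Hq. rewrite (proj2 (Nat.ltb_ge _ _)) by lia.
  assert (E : (if m =? 0 then Some 0
     else chk (appn q (rho k0 q) (x 0) (args q m k0 w)) (w m (S (S k0))) 0) = Some 0).
  { destruct (Nat.eqb_spec m 0); [reflexivity|]. destruct Hx as [Hx|Hx]; [contradiction|].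
    rewrite Hx. apply chk_eq. }
  rewrite E. simpl obind. destruct (Nat.ltb_spec m d); [|reflexivity].
  rewrite IH; [apply chk_eq|lia|lia|]. right. apply key_args; assumption.
Qed.

Lemma chain_outs q k0 d : outs (fun w => w 0 0) _ (chain q k0 d).
Proof.
  intros F nn. apply outs_arrn. intros x w. unfold chain. rewrite appn_lamn.
  destruct (nn w) as [m|]; [|auto]. simpl obind. destruct (d <? m); [auto|].
  match goal with |- obind ?o _ = _ \/ _ => destruct o; [|auto] end. simpl obind.
  destruct (m <? d); [apply chk_out|auto].
Qed.

(** * Reducibility relative to the remaining depth *)

Definition Pt (q : nat) (p : Fam N) : Prop :=
  (forall w, valid q w -> p w <> None) -> forall w w', valid q w -> valid q w' -> p w = p w'.

Lemma CC_Pt q : CC (Pt q).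
Proof.
  split.
  - intros _ w w' _ _. reflexivity.
  - intros c _ w w' _ _. reflexivity.
  - intros p k Hp Hk H w w' V V'.
    assert (T : forall w w', valid q w -> valid q w' -> p w = p w').
    { apply Hp. intros w1 V1 E. apply (H w1 V1). rewrite E; reflexivity. }
    rewrite (T w' w V' V). destruct (p w) as [c|] eqn:E; [|reflexivity]. simpl.
    apply Hk; auto. intros w1 V1 E1. apply (H w1 V1). rewrite (T w1 w V1 V), E. exact E1.
Qed.

Section Red.
Context (l k0 : nat).
Notation q := (S l).

(** Row [0] contains the answer and has no key, so the rows start from [1]. *)
Definition GG : pred_ty := fun T a => forall n, 1 <= n -> Gt q n k0 T a.
Definition Wt : pred_ty := LR GG (Pt q).

Definition GoodAt (r : nat) : pred_ty := fun T a => GG T a /\ forall n, r < n -> Qt q n k0 T a.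

Definition Good {V : Type} (vr : V -> nat) {T} (c : V -> Fam T) : Prop :=
  forall v, GoodAt (vr v) T (c v).

Lemma cls_GG : cls GG.
Proof. apply (cls_all _ (fun n => 1 <= n) (fun n => Gt q n k0)). intros n _. apply cls_tower. Qed.

Lemma cls_GoodAt r : cls (GoodAt r).
Proof.
  apply (cls_ext (meet GG (fun T a => forall n, r < n -> meet (Gt q n k0) (Qt q n k0) T a))).
  - intros T a. unfold GoodAt, meet. split; intros [H H']; split; auto.
    + intros n L. apply H', L.
    + intros n L. split; [apply H; lia|apply H', L].
  - apply cls_meet; [apply cls_GG|].
    apply (cls_all _ (fun n => r < n) (fun n => meet (Gt q n k0) (Qt q n k0))).
    intros n _. apply cls_tower.
Qed.

Lemma GoodAt_const r c : GoodAt r N (fun _ => Some c).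
Proof.
  apply (cls_den _ (cls_GoodAt r) [] (Num c) N _ (den_Num [] c) 0 (fun _ => tt)).
  intros n T p L. inversion L.
Qed.

Lemma GoodAt_le r r' T a : r <= r' -> GoodAt r T a -> GoodAt r' T a.
Proof. intros L [H H']; split; [exact H|]. intros; apply H'; lia. Qed.

(* A world [v : V] carries the depth [vd v] of the chain and the number [vr v] of nested calls
   of the chain made so far, so that only the keys of levels [<= vr v] are available. [Red]
   asserts [Pt] as long as enough depth is left, with a margin uniform over all worlds: a term
   without recursion can only go a bounded number of levels deeper. *)
Fixpoint Red (T : ty) (V : Type) (vd vr : V -> nat) : (V -> Fam T) -> Prop :=
  match T return (V -> Fam T) -> Prop with
  | N => fun a => exists m, forall v, vr v + m < vd v -> Pt q (a v)
  | Arr s u => fun a => forall (V' : Type) (pi : V' -> V) (vr' : V' -> nat),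
      (forall v', vr (pi v') <= vr' v') ->
      forall c : V' -> Fam s, Good vr' c -> Red s V' (fun v' => vd (pi v')) vr' c ->
      Red u V' (fun v' => vd (pi v')) vr' (fun v' w => a (pi v') w (c v' w))
  end.

Lemma Red_mono T : forall V vd vr a V' (pi : V' -> V) vr', (forall v', vr (pi v') <= vr' v') ->
  Red T V vd vr a -> Red T V' (fun v' => vd (pi v')) vr' (fun v' => a (pi v')).
Proof.
  destruct T as [|s u]; intros V vd vr a V' pi vr' L H.
  - destruct H as [m Hm]. exists m. intros v' H'. apply Hm. specialize (L v'). lia.
  - intros V2 pi2 vr2 L2 c Gc Rc. apply (H V2 (fun v => pi (pi2 v)) vr2); try assumption.
    intros v. eapply Nat.le_trans; [apply L|apply L2].
Qed.

Lemma Red_app s u V vd vr (f : V -> Fam (Arr s u)) (c : V -> Fam s) :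
  Red (Arr s u) V vd vr f -> Good vr c -> Red s V vd vr c ->
  Red u V vd vr (fun v w => f v w (c v w)).
Proof. intros Hf Gc Rc. exact (Hf V (fun v => v) vr (fun v => le_n _) c Gc Rc). Qed.

Lemma Red_bot T : forall V vd vr, Red T V vd vr (fun _ _ => bot T).
Proof.
  induction T as [|s _ u IH]; intros V vd vr.
  - exists 0. intros v _. apply (CC_none _ (CC_Pt q)).
  - intros V' pi vr' L c Gc Rc. apply IH.
Qed.

Lemma Red_const V vd vr (c : V -> nat) : Red N V vd vr (fun v _ => Some (c v)).
Proof. exists 0. intros v _. apply (CC_some _ (CC_Pt q)). Qed.

(** The arguments have sublevel at most [(S k0,l)], where [tower_sub] makes every member of [GG]
    good at any [vr]. Thus the number of calls matters only through the margin. *)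
Lemma Red_Wt T : sublevel_le T (S (S k0)) l -> forall V vd vr a,
  Red T V vd vr a <-> exists m, forall v, vr v + m < vd v -> Wt T (a v).
Proof.
  induction T as [|s IHs u IHu]; intros HT V vd vr a; [reflexivity|].
  assert (Hs : sublevel_le s (S k0) l) by (eapply sublevel_arg; eassumption).
  assert (Hs' : sublevel_le s (S (S k0)) l) by (apply sublevel_S; exact Hs).
  assert (Hu : sublevel_le u (S (S k0)) l) by (eapply sublevel_tail; eassumption).
  split.
  - intros H.
    (* The new worlds contain all admissible arguments at once, which makes the margin uniform in
       the argument. *)
    pose (V' := {vc : V * Fam s | Wt s (snd vc) /\ GG s (snd vc)}).
    assert (R : Red u V' (fun v' => vd (fst (proj1_sig v'))) (fun v' => vr (fst (proj1_sig v')))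
                  (fun v' w => a (fst (proj1_sig v')) w (snd (proj1_sig v') w))).
    { apply (H V' (fun v' => fst (proj1_sig v')) _ (fun v' => le_n _)
               (fun v' => snd (proj1_sig v'))).
      - intros [[v c] [Wc Gc]]. split; [exact Gc|]. intros n L.
        apply tower_sub; [exact Hs|apply Gc; lia].
      - apply IHs; [exact Hs'|]. exists 0. intros [[v c] [Wc Gc]] _. exact Wc. }
    apply IHu in R; [|exact Hu]. destruct R as [m Hm]. exists m. intros v L c Gc Wc.
    exact (Hm (exist _ (v, c) (conj Wc Gc)) L).
  - intros [m Hm] V' pi vr' L c Gc Rc. apply IHu; [exact Hu|].
    apply IHs in Rc; [|exact Hs']. destruct Rc as [m' Hm']. exists (Nat.max m m').
    intros v' L'. specialize (L v'). apply Hm; [lia|apply Gc|apply Hm'; lia].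
Qed.

Definition Renv {V : Type} (vd vr : V -> nat) (G : list ty) (g : V -> W -> env G) : Prop :=
  forall n T p, look G n T p ->
    Good vr (fun v w => p (g v w)) /\ Red T V vd vr (fun v w => p (g v w)).

(** The approximation index [vi] is read off the world, so one margin serves all iterates. The
    sublevel bound is needed at [Yc]. *)
Lemma Red_den G t T f : den G t T f -> Y_ok (fun s => sublevel_le s (S (S k0)) l) t ->
  forall V vd vr (vi : V -> nat) g, Renv vd vr G g -> Red T V vd vr (fun v w => f (vi v) (g v w)).
Proof.
  induction 1; intros OK V vd vr vi g Hg; simpl in OK.
  - apply (Hg _ _ _ H).
  - intros V' pi vr' L c Gc Rc.
    apply (IHden OK V' (fun v' => vd (pi v')) vr' (fun v' => vi (pi v'))
             (fun v' w => (c v' w, g (pi v') w))).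
    intros n T' p Hp. dependent destruction Hp; [split; assumption|].
    destruct (Hg _ _ _ Hp) as [Gp Rp]. split.
    + intros v'. apply (GoodAt_le _ _ _ _ (L v')), Gp.
    + apply (Red_mono _ _ _ _ _ V' pi vr' L Rp).
  - destruct OK as [OK1 OK2].
    apply (Red_app s T V vd vr _ _ (IHden1 OK1 V vd vr vi g Hg)).
    + intros v. apply (cls_den _ (cls_GoodAt (vr v)) _ _ _ _ H0).
      intros n T' p Hp. apply (Hg _ _ _ Hp).
    + apply IHden2; assumption.
  - apply Red_const.
  - intros V' pi vr' L c _ [m Hm]. exists m. intros v' L'.
    apply (CC_case _ (CC_Pt q) (c v') (fun n _ => Some (S n)) (Hm v' L')).
    intros n. apply (CC_some _ (CC_Pt q)).
  - intros V' pi vr' L c _ [m Hm]. exists m. intros v' L'.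
    apply (CC_case _ (CC_Pt q) (c v') (fun n _ => Some (pred n)) (Hm v' L')).
    intros n. apply (CC_some _ (CC_Pt q)).
  - intros V1 p1 r1 L1 a _ [ma Ha] V2 p2 r2 L2 b _ [mb Hb] V3 p3 r3 L3 c _ [mc Hc].
    exists (Nat.max ma (Nat.max mb mc)). intros v Lv.
    specialize (L3 v). specialize (L2 (p3 v)).
    apply (CC_case _ (CC_Pt q) (a (p2 (p3 v)))
             (fun n w => match n with 0 => b (p3 v) w | S _ => c v w end)).
    + apply Ha. lia.
    + intros [|n]; [apply Hb|apply Hc]; lia.
  - intros V' pi vr' L F GF RF. apply Red_Wt; [exact OK|].
    (* One application of [F] is examined on all [z] at once; the resulting margin is the same for
       every iteration and does not accumulate. *)
    pose (V2 := {vz : V' * Fam s | Wt s (snd vz) /\ GoodAt (vr' (fst vz)) s (snd vz)}).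
    assert (R : Red s V2 (fun v2 => vd (pi (fst (proj1_sig v2)))) (fun v2 => vr' (fst (proj1_sig v2)))
                  (fun v2 w => F (fst (proj1_sig v2)) w (snd (proj1_sig v2) w))).
    { apply (RF V2 (fun v2 => fst (proj1_sig v2)) _ (fun v2 => le_n _)
               (fun v2 => snd (proj1_sig v2))).
      - intros [[v z] [Wz Gz]]. exact Gz.
      - apply Red_Wt; [exact OK|]. exists 0. intros [[v z] [Wz Gz]] _. exact Wz. }
    apply Red_Wt in R; [|exact OK]. destruct R as [m Hm]. exists m. intros v' Lv.
    assert (K : forall i, Wt s (fun w => Nat.iter i (F v' w) (bot s)) /\
                          GoodAt (vr' v') s (fun w => Nat.iter i (F v' w) (bot s))).
    { induction i as [|i IH].
      - split; [apply LR_bot, (CC_none _ (CC_Pt q))|apply (cls_bot _ (cls_GoodAt _))].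
      - split; [exact (Hm (exist _ (v', _) IH) Lv)|].
        exact (cls_app _ (cls_GoodAt _) _ _ _ _ (GF v') (proj2 IH)). }
    apply K.
  - intros V' pi vr' L c _ [m Hm]. exists m. intros v' L'.
    apply (CC_case _ (CC_Pt q) (c v') (fun n _ => f n) (Hm v' L')).
    intros n. destruct (f n); [apply (CC_some _ (CC_Pt q))|apply (CC_none _ (CC_Pt q))].
Qed.

Lemma Red_arrn_intro a b : forall V vd vr (f : V -> Fam (arrn b a N)),
  (forall V' (pi : V' -> V) vr', (forall v', vr (pi v') <= vr' v') ->
   forall x : nat -> V' -> Fam a,
   (forall j, Good vr' (x j) /\ Red a V' (fun v' => vd (pi v')) vr' (x j)) ->
   exists m, forall v', vr' v' + m < vd (pi v') ->
     Pt q (fun w => appn b a (f (pi v') w) (fun j => x j v' w))) ->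
  Red (arrn b a N) V vd vr f.
Proof.
  induction b as [|b IH]; intros V vd vr f H; simpl in *.
  - apply (H V (fun v => v) vr (fun v => le_n _) (fun _ _ _ => bot a)).
    intros _. split; [|apply Red_bot]. intros v. apply (cls_bot _ (cls_GoodAt _)).
  - intros V1 p1 r1 L1 c Gc Rc. apply IH. intros V2 p2 r2 L2 x Hx.
    apply (H V2 (fun v => p1 (p2 v)) r2) with (x := scons (fun v => c (p2 v)) x).
    + intros v. eapply Nat.le_trans; [apply L1|apply L2].
    + intros [|j]; [|apply Hx]. split.
      * intros v. apply (GoodAt_le _ _ _ _ (L2 v)), Gc.
      * apply (Red_mono _ _ _ _ _ V2 p2 r2 L2 Rc).
Qed.

Lemma Red_arrn_elim a b : forall V vd vr (f : V -> Fam (arrn b a N)), Red (arrn b a N) V vd vr f ->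
  forall x : nat -> V -> Fam a, (forall j, Good vr (x j) /\ Red a V vd vr (x j)) ->
  exists m, forall v, vr v + m < vd v -> Pt q (fun w => appn b a (f v w) (fun j => x j v w)).
Proof.
  induction b as [|b IH]; intros V vd vr f H x Hx; simpl in *; [exact H|].
  apply (IH V vd vr (fun v w => f v w (x 0 v w))) with (x := fun j => x (S j)).
  - apply (Red_app _ _ _ _ _ _ (x 0) H); apply Hx.
  - intros j. apply Hx.
Qed.

Lemma lv_arrn a b : lv (arrn b a N) <= S (lv a).
Proof. induction b; cbn [lv arrn]; lia. Qed.

Lemma lv_rho i b : lv (rho i b) <= i.
Proof.
  induction i as [|i IH]; [reflexivity|]. cbn [rho].
  pose proof (lv_arrn (rho i b) b). lia.
Qed.

Hypothesis Hl : 1 <= l.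

(** [Pt] is vacuous: on guarded arguments the key is undefined at some table. *)
Lemma Wt_key m : 1 <= m -> Wt _ (key q m k0).
Proof.
  intros Hm. apply (LR_arrn_intro _ _ (rho k0 q)); [apply (cls_bot _ cls_GG)|
    apply (CC_none _ (CC_Pt q))|].
  intros x Hx T. exfalso.
  destruct (key_spec q m k0) as [_ [K _]]; [lia|].
  destruct (K x (fun j => proj1 (Hx j) m Hm) (fun _ _ => 0)) as [w [Vw [_ E]]].
  { intros ? ?; lia. }
  exact (T w Vw E).
Qed.

Lemma GoodAt_key m r : m <= r -> GoodAt r _ (key q m k0).
Proof.
  intros Hm. split.
  - intros n Hn. destruct (Nat.eq_dec m n) as [->|NE].
    + apply key_spec. lia.
    + apply (key_tower_other q n m k0); lia.
  - intros n Hn. apply (key_tower_other q n m k0); lia.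
Qed.

Lemma Pt_not_secret (p : Fam N) : Pt q p -> exists w, valid q w /\ p w <> Some (w 0 0).
Proof.
  intros Hp. apply NNPP. intros H.
  assert (K : forall w, valid q w -> p w = Some (w 0 0)).
  { intros w Vw. apply NNPP. intros E. apply H. exists w; auto. }
  assert (E : p (fun _ _ => 0) = p (fun _ _ => 1)).
  { apply Hp; [intros w Vw; rewrite K; [discriminate|exact Vw]|..]; intros ? ?; lia. }
  rewrite K, K in E; [discriminate|intros ? ?; lia..].
Qed.

Notation sigma := (Arr N (rho (S (S k0)) q)).

(** Within the margin the result is never total, so [Pt] is vacuous. If the level is at most the
    number of calls made, the deeper call satisfies [Pt] and differs from the answer at some table;
    if it is greater, [x 0] fails the test at some table. *)
Lemma Red_chain V (vd vr : V -> nat) : Red (Arr sigma sigma) V vd vr (fun v => chain q k0 (vd v)).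
Proof.
  intros V1 p1 r1 L1 F GF RF V2 p2 r2 L2 nn Gn Rn.
  apply (Red_arrn_intro (rho (S k0) q) q). intros V3 p3 r3 L3 x Hx.
  destruct Rn as [m1 Hm1].
  pose (V4 := {vm : V3 * nat | snd vm <= r3 (fst vm)}).
  pose (p4 := fun v : V4 => fst (proj1_sig v)).
  pose (mm := fun v : V4 => snd (proj1_sig v)).
  (* The call at level [S m] hands out the key of that level, so it counts as one more; the [S M]
     below pays for it. *)
  pose (r4 := fun v : V4 => S (r3 (p4 v))).
  assert (R : exists M, forall v : V4, r4 v + M < vd (p1 (p2 (p3 (p4 v)))) ->
    Pt q (fun w => appn q (rho (S k0) q) (F (p2 (p3 (p4 v))) w (Some (S (mm v))))
                     (args q (S (mm v)) (S k0) w))).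
  { apply (Red_arrn_elim (rho (S k0) q) q V4 (fun v => vd (p1 (p2 (p3 (p4 v))))) r4
      (fun v w => F (p2 (p3 (p4 v))) w (Some (S (mm v)))))
      with (x := fun j v w => args q (S (mm v)) (S k0) w j).
    - apply (RF V4 (fun v => p2 (p3 (p4 v))) r4) with (c := fun v w => Some (S (mm v))).
      + intros v. unfold r4. specialize (L3 (p4 v)). specialize (L2 (p3 (p4 v))). lia.
      + intros v. apply GoodAt_const.
      + apply Red_const.
    - intros [|j].
      + split.
        * intros [[v m] Hm]. unfold r4, mm, p4. simpl in *. apply GoodAt_key. lia.
        * apply (Red_Wt (rho (S k0) q)).
          { right; left. pose proof (lv_rho (S k0) q). lia. }
          exists 0. intros v _. apply Wt_key. lia.
      + split; [intros v; apply (cls_bot _ (cls_GoodAt _))|apply Red_bot]. }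
  destruct R as [M HM]. exists (Nat.max m1 (S M)). intros v Lv T. exfalso.
  assert (Pn : Pt q (nn (p3 v))).
  { apply Hm1. specialize (L3 v). lia. }
  (* The requested level could vary with the table, but being total and in [Pt] it is constant. *)
  assert (En : exists m, forall w, valid q w -> nn (p3 v) w = Some m).
  { assert (V0 : valid q (fun _ _ => 0)) by (intros ? ?; lia).
    assert (Tn : forall w, valid q w -> nn (p3 v) w <> None).
    { intros w Vw E. apply (T w Vw). unfold chain. rewrite appn_lamn, E. reflexivity. }
    destruct (nn (p3 v) (fun _ _ => 0)) as [m|] eqn:E; [|elim (Tn _ V0 E)].
    exists m. intros w Vw. rewrite <- E. apply Pn; assumption. }
  destruct En as [m Em].
  assert (T' : forall w, valid q w ->
    appn q (rho (S k0) q) (chain q k0 (vd (p1 (p2 (p3 v)))) w (F (p2 (p3 v)) w) (Some m))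
      (fun j => x j v w) <> None).
  { intros w Vw. rewrite <- (Em w Vw). apply T, Vw. }
  destruct (Nat.le_gt_cases m (r3 v)) as [Lm|Lm].
  - destruct (Pt_not_secret _ (HM (exist _ (v, m) Lm : V4) ltac:(unfold r4, p4; simpl; lia)))
      as [w [Vw E]].
    apply (T' w Vw). rewrite appn_chain by lia. rewrite (proj2 (Nat.ltb_ge _ _)) by lia.
    rewrite (proj2 (Nat.ltb_lt m _)) by lia.
    match goal with |- obind ?o _ = None => destruct o; [|reflexivity] end.
    apply chk_neq, E.
  - destruct (key_spec q m k0) as [K _]; [lia|].
    destruct (K (x 0 v)) with (w0 := fun _ _ : nat => 0) as [w [Vw [_ E]]].
    + apply (proj1 (Hx 0) v). exact Lm.
    + intros ? ?; lia.
    + apply (T' w Vw). rewrite appn_chain by lia. destruct (_ <? m); [reflexivity|].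
      rewrite (proj2 (Nat.eqb_neq _ _)) by lia. rewrite chk_neq by exact E. reflexivity.
Qed.

Lemma closed_Pt M f : den [] M (Arr (Arr sigma sigma) sigma) f ->
  Y_ok (fun s => sublevel_le s (S (S k0)) l) M ->
  exists d, forall i, Pt q (fun w =>
    appn q (rho (S k0) q) (f i tt (chain q k0 d w) (Some 0)) (fun _ => bot _)).
Proof.
  intros HM OK.
  (* Worlds pair an iteration index with a depth, so the depth found is good for all indices. *)
  pose (vd := fun v : nat * nat => snd v). pose (vr := fun _ : nat * nat => 0).
  assert (R : Red _ (nat * nat) vd vr (fun v w => f (fst v) tt)).
  { apply (Red_den _ _ _ _ HM OK _ vd vr fst (fun _ _ => tt)). intros n T p L. inversion L. }
  assert (R1 : Red sigma (nat * nat) vd vr (fun v w => f (fst v) tt (chain q k0 (snd v) w))).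
  { apply (Red_app (Arr sigma sigma) sigma _ vd vr _ (fun v => chain q k0 (snd v)) R).
    - intros v. split; intros n Hn.
      + apply (tower_outs q n (fun w => w 0 0) k0); [lia| |apply chain_outs].
        intros w w' A. apply A. lia.
      + apply (tower_outs q n (fun w => w 0 0) k0); [lia| |apply chain_outs].
        intros w w' A. apply A. unfold vr in Hn. lia.
    - apply (Red_chain _ vd vr). }
  assert (R2 := Red_app N _ _ vd vr _ (fun _ _ => Some 0) R1
    (fun v => GoodAt_const _ _) (Red_const _ _ _ (fun _ => 0))).
  destruct (Red_arrn_elim (rho (S k0) q) q _ _ _ _ R2 (fun _ _ _ => bot _)) as [m Hm].
  { intros _. split; [intros v; apply (cls_bot _ (cls_GoodAt _))|apply Red_bot]. }
  exists (S m). intros i. apply (Hm (i, S m)). unfold vr, vd. simpl. lia.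
Qed.
End Red.

(** * Definability *)

Lemma Y_ok_lift P t : forall c, Y_ok P t -> Y_ok P (lift c t).
Proof.
  induction t; simpl; intros c H; auto.
  - destruct (n <? c); exact I.
  - destruct H; auto.
Qed.

Lemma Y_ok_impl (P Q : ty -> Prop) t : (forall s, P s -> Q s) -> Y_ok P t -> Y_ok Q t.
Proof. intros H. induction t; simpl; auto. intros [H1 H2]; auto. Qed.

Section Definability.
Context (P : ty -> Prop).

(** [P] stays arbitrary because the terms constructed in this section contain no recursors. *)
Definition Dfn (G : list ty) (T : ty) (f : nat -> env G -> D T) : Prop :=
  exists t, Y_ok P t /\ den G t T f.

Definition Wk (G G' : list ty) (h : env G' -> env G) : Prop :=
  forall T f, Dfn G T f -> Dfn G' T (fun i g => f i (h g)).

Lemma Dfn_ext G T f f' : Dfn G T f -> (forall i g, f i g = f' i g) -> Dfn G T f'.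
Proof.
  intros H E. replace f' with f; [exact H|]. extensionality i; extensionality g; apply E.
Qed.

Lemma Dfn_app G s T f x : Dfn G (Arr s T) f -> Dfn G s x -> Dfn G T (fun i g => f i g (x i g)).
Proof.
  intros [t [Ot Ht]] [u [Ou Hu]]. exists (App t u). split; [split; assumption|].
  econstructor; eassumption.
Qed.

Lemma Wk_id G : Wk G G (fun g => g).
Proof. intros T f H. exact H. Qed.

Lemma Wk_snd G G' s h : Wk (s :: G) G' h -> Wk G G' (fun g => snd (h g)).
Proof.
  intros H T f [t [Ot Ht]]. apply (H T (fun i g => f i (snd g))).
  exists (lift 0 t). split; [apply Y_ok_lift, Ot|]. exact (den_lift t [] s G T f Ht).
Qed.

Lemma Wk_fst G G' s h : Wk (s :: G) G' h -> Dfn G' s (fun _ g => fst (h g)).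
Proof.
  intros H. apply (H s (fun _ g => fst g)). exists (Var 0). split; [exact I|].
  constructor. constructor.
Qed.

(** As in higher-order abstract syntax, the bound variable becomes an arbitrary definable [x] over a
    weakened context, which hides the indices. *)
Lemma Dfn_lam G s T (F : nat -> env G -> D s -> D T) :
  (forall G' h x, Wk G G' h -> Dfn G' s x -> Dfn G' T (fun i g => F i (h g) (x i g))) ->
  Dfn G (Arr s T) F.
Proof.
  intros H.
  assert (I0 : Wk (s :: G) (s :: G) (fun g => g)) by apply Wk_id.
  destruct (H (s :: G) _ _ (Wk_snd _ _ _ _ I0) (Wk_fst _ _ _ _ I0)) as [t [Ot Ht]].
  exists (Lam s t). split; [exact Ot|]. exact (den_Lam _ _ _ _ _ Ht).
Qed.

Lemma Dfn_some G n : Dfn G N (fun _ _ => Some n).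
Proof. exists (Num n). split; [exact I|constructor]. Qed.

Lemma Dfn_Cf G c p : Dfn G N p -> Dfn G N (fun i g => obind (p i g) c).
Proof.
  intros H. apply (Dfn_app G N N (fun _ _ x => obind x c) p); [|exact H].
  exists (Cf c). split; [exact I|constructor].
Qed.

Lemma Dfn_bot T : forall G, Dfn G T (fun _ _ => bot T).
Proof.
  induction T as [|s _ u IH]; intros G.
  - apply (Dfn_Cf G (fun _ => None) _ (Dfn_some G 0)).
  - apply Dfn_lam. intros; apply IH.
Qed.

Lemma Dfn_chk G o a b : Dfn G N o -> Dfn G N (fun i g => chk (o i g) a b).
Proof. apply Dfn_Cf. Qed.

Lemma Dfn_ifz G p a b : Dfn G N p -> Dfn G N a -> Dfn G N b ->
  Dfn G N (fun i g => obind (p i g) (fun n => match n with 0 => a i g | S _ => b i g end)).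
Proof.
  intros Hp Ha Hb.
  apply (Dfn_app G N N (fun i g z => obind (p i g) (fun n => match n with 0 => a i g | S _ => z end)) b);
    [|exact Hb].
  apply (Dfn_app G N (Arr N N)
    (fun i g y z => obind (p i g) (fun n => match n with 0 => y | S _ => z end)) a); [|exact Ha].
  apply (Dfn_app G N (Arr N (Arr N N))
    (fun i g x y z => obind x (fun n => match n with 0 => y | S _ => z end)) p); [|exact Hp].
  exists Ifz. split; [exact I|constructor].
Qed.

Lemma Dfn_seq G p b : Dfn G N p -> Dfn G N b -> Dfn G N (fun i g => obind (p i g) (fun _ => b i g)).
Proof.
  intros Hp Hb. apply (Dfn_ext _ _ _ _ (Dfn_ifz _ _ _ _ Hp Hb Hb)).
  intros i g. destruct (p i g) as [[|n]|]; reflexivity.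
Qed.

Lemma Dfn_case G d : forall p (B : nat -> nat -> env G -> D N),
  Dfn G N p -> (forall m, m <= d -> Dfn G N (B m)) ->
  Dfn G N (fun i g => obind (p i g) (fun m => if d <? m then None else B m i g)).
Proof.
  induction d as [|d IH]; intros p B Hp HB.
  - apply (Dfn_ext _ _ _ _ (Dfn_ifz _ _ _ _ Hp (HB 0 (le_n _)) (Dfn_bot N G))).
    intros i g. destruct (p i g) as [[|n]|]; reflexivity.
  - assert (Hq : Dfn G N (fun i g => obind (obind (p i g) (fun n => Some (pred n)))
              (fun m => if d <? m then None else B (S m) i g))).
    { apply (IH (fun i g => obind (p i g) (fun n => Some (pred n))) (fun m => B (S m))).
      - apply Dfn_Cf, Hp.
      - intros m Hm. apply HB. lia. }
    apply (Dfn_ext _ _ _ _ (Dfn_ifz _ _ _ _ Hp (HB 0 ltac:(lia)) Hq)).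
    intros i g. destruct (p i g) as [[|n]|]; reflexivity.
Qed.

Lemma Dfn_appn a q : forall G f x, Dfn G (arrn q a N) f -> (forall j, Dfn G a (x j)) ->
  Dfn G N (fun i g => appn q a (f i g) (fun j => x j i g)).
Proof.
  induction q as [|q IH]; intros G f x Hf Hx; simpl in *; [exact Hf|].
  apply (IH G (fun i g => f i g (x 0 i g)) (fun j => x (S j))).
  - apply (Dfn_app G a (arrn q a N)); auto.
  - intros j; apply Hx.
Qed.

Lemma Dfn_lamn a q : forall G (F : nat -> env G -> (nat -> D a) -> D N),
  (forall G' h x, Wk G G' h -> (forall j, Dfn G' a (x j)) ->
     Dfn G' N (fun i g => F i (h g) (fun j => x j i g))) ->
  Dfn G (arrn q a N) (fun i g => lamn q a (F i g)).
Proof.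
  induction q as [|q IH]; intros G F H; simpl.
  - apply (H G (fun g => g) (fun _ _ _ => bot a)); [apply Wk_id|intros; apply Dfn_bot].
  - apply (Dfn_lam G a (arrn q a N) (fun i g x0 => lamn q a (fun x => F i g (scons x0 x)))).
    intros G1 h1 x0 W1 H0.
    apply (IH G1 (fun i g x => F i (h1 g) (scons (x0 i g) x))).
    intros G2 h2 x W2 Hx.
    apply (Dfn_ext _ _ (fun i g => F i (h1 (h2 g)) (fun j => scons (fun i g => x0 i (h2 g)) x j i g))).
    + apply (H G2 (fun g => h1 (h2 g)) (scons (fun i g => x0 i (h2 g)) x)).
      * intros T f Hf. apply (W2 T (fun i g => f i (h1 g))), W1, Hf.
      * intros [|j]; [apply (W2 a x0 H0)|apply Hx].
    + intros i g. f_equal. extensionality j. destruct j; reflexivity.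
Qed.

Lemma Dfn_key_args q n w i :
  (forall G, Dfn G (rho (S i) q) (fun _ _ => key q n i w)) /\
  (forall G j, Dfn G (rho i q) (fun _ _ => args q n i w j)).
Proof.
  induction i as [|i [IH1 IH2]].
  - split.
    + intros G. apply (Dfn_lamn N q G (fun _ _ u => chk (u (w n 0)) (w n 1) (w n 2))).
      intros G' h x _ Hx. apply Dfn_chk, Hx.
    + intros G j. simpl. destruct (j =? w n 0); [apply Dfn_some|apply (Dfn_bot N)].
  - split.
    + intros G. apply (Dfn_lamn (rho (S i) q) q G (fun _ _ x =>
        chk (appn q (rho i q) (x 0) (args q n i w)) (w n (S (S i))) (w n (S (S (S i)))))).
      intros G' h x _ Hx. apply Dfn_chk.
      apply (Dfn_appn (rho i q) q G' (x 0) (fun j _ _ => args q n i w j)); [apply Hx|intros; apply IH2].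
    + intros G [|j]; [apply IH1|apply Dfn_bot].
Qed.

(** With [w] and [d] fixed, a finite case distinction on the level suffices; the secrets are built
    into numerals and oracles. *)
Lemma Dfn_chain q k0 d w G : Dfn G _ (fun _ _ => chain q k0 d w).
Proof.
  apply Dfn_lam. intros G1 h1 F _ HF.
  apply (Dfn_lam G1 N (rho (S (S k0)) q) (fun i g nn => chain q k0 d w (F i g) nn)).
  intros G2 h2 nn W2 Hn. apply (W2 _ F) in HF.
  apply (Dfn_lamn (rho (S k0) q) q G2 (fun i g x =>
    obind (nn i g) (fun m => if d <? m then None else
      obind (if m =? 0 then Some 0
             else chk (appn q (rho k0 q) (x 0) (args q m k0 w)) (w m (S (S k0))) 0)
        (fun _ => if m <? d
           then chk (appn q (rho (S k0) q) (F i (h2 g) (Some (S m))) (args q (S m) (S k0) w))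
                                    (w 0 0) (w 0 0)
           else Some (w 0 0))))).
  intros G3 h3 x W3 Hx. apply (W3 _ _) in HF. apply (W3 _ nn) in Hn.
  apply (Dfn_case G3 d (fun i g => nn i (h3 g)) (fun m i g =>
      obind (if m =? 0 then Some 0
             else chk (appn q (rho k0 q) (x 0 i g) (args q m k0 w)) (w m (S (S k0))) 0)
        (fun _ => if m <? d
           then chk (appn q (rho (S k0) q) (F i (h2 (h3 g)) (Some (S m))) (args q (S m) (S k0) w))
                                    (w 0 0) (w 0 0)
           else Some (w 0 0)))); [exact Hn|].
  intros m _.
  apply (Dfn_seq G3 (fun i g => if m =? 0 then Some 0
             else chk (appn q (rho k0 q) (x 0 i g) (args q m k0 w)) (w m (S (S k0))) 0)).
  - destruct (m =? 0); [apply Dfn_some|]. apply Dfn_chk.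
    apply (Dfn_appn (rho k0 q) q G3 (x 0) (fun j _ _ => args q m k0 w j));
      [apply Hx|intros; apply Dfn_key_args].
  - destruct (m <? d); [|apply Dfn_some]. apply Dfn_chk.
    apply (Dfn_appn (rho (S k0) q) q G3 (fun i g => F i (h2 (h3 g)) (Some (S m)))
       (fun j _ _ => args q (S m) (S k0) w j)); [|intros; apply Dfn_key_args].
    apply (Dfn_app G3 N _ (fun i g => F i (h2 (h3 g))) (fun _ _ => Some (S m)));
      [exact HF|apply Dfn_some].
Qed.
End Definability.

(** * Coding tuples in pure types *)

Lemma appn_ext q a : forall f x y, (forall j, j < q -> x j = y j) -> appn q a f x = appn q a f y.
Proof.
  induction q as [|q IH]; intros f x y H; simpl; [reflexivity|].
  rewrite (H 0) by lia. apply IH. intros j Hj. apply (H (S j)). lia.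
Qed.

Lemma lamn_appn q a : forall f, lamn q a (appn q a f) = f.
Proof.
  induction q as [|q IH]; intros f; simpl; [reflexivity|].
  extensionality x0. apply IH.
Qed.

Lemma lamn_appn_ext q a f F :
  (forall x, F x = appn q a f x) -> lamn q a F = f.
Proof. intros H. rewrite (lamn_ext _ _ F (appn q a f)); [apply lamn_appn|intros; apply H]. Qed.

Section Coding.
Context (q : nat).

(* The code of [(n, x)] reads its one argument as the code of some [(i, s)]: the index [i]
   selects a component, which is then applied to the tuple [s]. *)
Fixpoint coding (j : nat) :
    (D N -> (nat -> D (rho j q)) -> D (pure (S j))) *
    ((D (pure (S j)) -> D N) * (D (pure (S j)) -> nat -> D (rho j q))) :=
  match j return (D N -> (nat -> D (rho j q)) -> D (pure (S j))) *
    ((D (pure (S j)) -> D N) * (D (pure (S j)) -> nat -> D (rho j q))) with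
  | 0 => (fun n u i => obind i (fun m => if q <? m then None else
                                 match m with 0 => n | S a => u a end),
          (fun g => g (Some 0), fun g a => g (Some (S a))))
  | S j' =>
      let cod := fst (coding j') in
      let dec1 := fst (snd (coding j')) in
      let dec2 := snd (snd (coding j')) in
      (fun n x Y => obind (dec1 Y) (fun m => if q <? m then None else
                      match m with 0 => n | S a => appn q (rho j' q) (x a) (dec2 Y) end),
       (fun F => F (cod (Some 0) (fun _ => bot _)),
        fun F a => lamn q (rho j' q) (fun s => F (cod (Some (S a)) s))))
  end.

Definition cod j := fst (coding j).
Definition dec1 j := fst (snd (coding j)).
Definition dec2 j := snd (snd (coding j)).

(** This one composite is all that the retraction [ret_enc] asks for. *)
Lemma dec_cod j : forall n x, dec1 j (cod j n x) = n /\
  forall a, a < q -> dec2 j (cod j n x) a = x a.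
Proof.
  induction j as [|j IH]; intros n x.
  - split; [reflexivity|]. intros a La. change ((if q <? S a then None else x a) = x a).
    rewrite (proj2 (Nat.ltb_ge _ _)) by lia. reflexivity.
  - split.
    + change (obind (dec1 j (cod j (Some 0) (fun _ => bot _))) (fun m => if q <? m then None else
        match m with 0 => n | S a => appn q (rho j q) (x a) (dec2 j (cod j (Some 0) (fun _ => bot _))) end)
        = n).
      rewrite (proj1 (IH _ _)). reflexivity.
    + intros a La. apply (lamn_appn_ext q (rho j q)). intros s.
      change (obind (dec1 j (cod j (Some (S a)) s)) (fun m => if q <? m then None else
        match m with 0 => n | S b => appn q (rho j q) (x b) (dec2 j (cod j (Some (S a)) s)) end)
        = appn q (rho j q) (x a) s).
      rewrite (proj1 (IH _ _)). simpl obind. rewrite (proj2 (Nat.ltb_ge _ _)) by lia.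
      apply appn_ext. apply IH.
Qed.

Definition enc j (f : D (Arr N (rho (S j) q))) : D (pure (S (S j))) :=
  fun Y => appn q (rho j q) (f (dec1 j Y)) (dec2 j Y).

Definition ret j (F : D (pure (S (S j)))) : D (Arr N (rho (S j) q)) :=
  fun n => lamn q (rho j q) (fun x => F (cod j n x)).

Lemma ret_enc j f : ret j (enc j f) = f.
Proof.
  extensionality n. apply (lamn_appn_ext q (rho j q)). intros x. unfold enc.
  rewrite (proj1 (dec_cod j n x)). apply appn_ext. apply dec_cod.
Qed.

Context (P : ty -> Prop).

Lemma Dfn_coding j :
  (forall G n x, Dfn P G N n -> (forall a, Dfn P G (rho j q) (x a)) ->
     Dfn P G (pure (S j)) (fun i g => cod j (n i g) (fun a => x a i g))) /\
  (forall G Y, Dfn P G (pure (S j)) Y -> Dfn P G N (fun i g => dec1 j (Y i g))) /\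
  (forall G Y a, Dfn P G (pure (S j)) Y -> Dfn P G (rho j q) (fun i g => dec2 j (Y i g) a)).
Proof.
  induction j as [|j [IH1 [IH2 IH3]]].
  - split; [|split].
    + intros G n x Hn Hx. apply (Dfn_lam P G N N). intros G' h y W Hy.
      apply (Dfn_case P G' q y (fun m i g => match m with 0 => n i (h g) | S a => x a i (h g) end) Hy).
      intros [|a] _; [apply (W N n Hn)|apply (W N (x a)), Hx].
    + intros G Y HY. apply (Dfn_app P G N N Y (fun _ _ => Some 0) HY). apply Dfn_some.
    + intros G Y a HY. apply (Dfn_app P G N N Y (fun _ _ => Some (S a)) HY). apply Dfn_some.
  - split; [|split].
    + intros G n x Hn Hx. apply (Dfn_lam P G (pure (S j)) N). intros G' h Y W HY.
      apply (Dfn_case P G' q (fun i g => dec1 j (Y i g)) (fun m i g =>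
        match m with 0 => n i (h g) | S a => appn q (rho j q) (x a i (h g)) (dec2 j (Y i g)) end)).
      * apply IH2, HY.
      * intros [|a] _; [apply (W N n Hn)|].
        apply (Dfn_appn P (rho j q) q G' (fun i g => x a i (h g)) (fun b i g => dec2 j (Y i g) b)).
        -- apply (W _ (x a)), Hx.
        -- intros b. apply IH3, HY.
    + intros G Y HY.
      apply (Dfn_app P G (pure (S j)) N Y (fun _ _ => cod j (Some 0) (fun _ => bot _)) HY).
      apply (IH1 G (fun _ _ => Some 0) (fun _ _ _ => bot _)); [apply Dfn_some|intros; apply Dfn_bot].
    + intros G Y a HY.
      apply (Dfn_lamn P (rho j q) q G (fun i g s => Y i g (cod j (Some (S a)) s))).
      intros G' h x W Hx.
      apply (Dfn_app P G' (pure (S j)) N (fun i g => Y i (h g)) 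
        (fun i g => cod j (Some (S a)) (fun b => x b i g))); [apply (W _ Y HY)|].
      apply (IH1 G' (fun _ _ => Some (S a)) x); [apply Dfn_some|exact Hx].
Qed.

Lemma Dfn_enc j G : Dfn P G (Arr (Arr N (rho (S j) q)) (pure (S (S j)))) (fun _ _ => enc j).
Proof.
  apply Dfn_lam. intros G1 h1 f _ Hf.
  apply (Dfn_lam P G1 (pure (S j)) N). intros G2 h2 Y W2 HY.
  apply (Dfn_appn P (rho j q) q G2 (fun i g => f i (h2 g) (dec1 j (Y i g)))
    (fun a i g => dec2 j (Y i g) a)).
  - apply (Dfn_app P G2 N (rho (S j) q) (fun i g => f i (h2 g))); [apply (W2 _ f Hf)|].
    apply Dfn_coding, HY.
  - intros a. apply Dfn_coding, HY.
Qed.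

Lemma Dfn_ret j G : Dfn P G (Arr (pure (S (S j))) (Arr N (rho (S j) q))) (fun _ _ => ret j).
Proof.
  apply Dfn_lam. intros G1 h1 F _ HF.
  apply (Dfn_lam P G1 N (rho (S j) q)). intros G2 h2 n W2 Hn.
  apply (Dfn_lamn P (rho j q) q G2 (fun i g x => F i (h2 g) (cod j (n i g) x))).
  intros G3 h3 x W3 Hx.
  apply (Dfn_app P G3 (pure (S j)) N (fun i g => F i (h2 (h3 g)))
    (fun i g => cod j (n i (h3 g)) (fun a => x a i g))).
  - apply (W3 _ (fun i g => F i (h2 g))), (W2 _ F), HF.
  - apply Dfn_coding; [apply (W3 _ n Hn)|exact Hx].
Qed.
End Coding.

(** * Uniformity over the secrets *)

Lemma key_args_local q n w w' i :
  ((forall c, c <= S (S i) -> w n c = w' n c) -> key q n i w = key q n i w') /\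
  ((forall c, c <= S i -> w n c = w' n c) -> args q n i w = args q n i w').
Proof.
  induction i as [|i [IH1 IH2]].
  - split; intros H.
    + simpl. rewrite !H by lia. reflexivity.
    + extensionality j. simpl. rewrite !H by lia. reflexivity.
  - split; intros H.
    + change (key q n (S i)) with (fun w => lamn q (rho (S i) q) (fun x =>
        chk (appn q (rho i q) (x 0) (args q n i w)) (w n (S (S i))) (w n (S (S (S i)))))).
      simpl. rewrite !H, IH2 by (intros; try apply H; lia). reflexivity.
    + extensionality j. destruct j; simpl; [|reflexivity]. apply IH1. exact H.
Qed.

Lemma chain_local q k0 d w w' :
  (forall m c, m <= d -> c <= S (S k0) -> w m c = w' m c) -> chain q k0 d w = chain q k0 d w'.
Proof.
  intros H. extensionality F; extensionality nn. unfold chain. f_equal. extensionality x.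
  destruct nn as [m|]; [|reflexivity]. cbn [obind]. destruct (Nat.ltb_spec d m); [reflexivity|].
  rewrite (H 0 0), (H m (S (S k0))) by lia.
  rewrite (proj2 (key_args_local q m w w' k0)) by (intros; apply H; lia).
  destruct (Nat.ltb_spec m d); [|reflexivity].
  rewrite (proj2 (key_args_local q (S m) w w' (S k0))) by (intros; apply H; lia). reflexivity.
Qed.

Lemma bounded_choice (Q : nat -> nat -> Prop) b :
  (forall v i j, Q v i -> i <= j -> Q v j) -> (forall v, v < b -> exists i, Q v i) ->
  exists i, forall v, v < b -> Q v i.
Proof.
  intros M. induction b as [|b IH]; intros H; [exists 0; intros; lia|].
  destruct IH as [i Hi]; [intros; apply H; lia|]. destruct (H b) as [j Hj]; [lia|].
  exists (Nat.max i j). intros v Lv. destruct (Nat.eq_dec v b) as [->|NE].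
  - apply (M _ j); [exact Hj|lia].
  - apply (M _ i); [apply Hi; lia|lia].
Qed.

(** [L] lists the entries allowed to differ from [w0]. Each has [q] possible values, so the maximum
    of finitely many indices works. *)
Lemma uniform_coords q (Q : W -> nat -> Prop) :
  (forall w i j, Q w i -> i <= j -> Q w j) -> (forall w, valid q w -> exists i, Q w i) ->
  forall L w0, valid q w0 -> exists i, forall w, valid q w ->
    (forall m c, ~ In (m, c) L -> w m c = w0 m c) -> Q w i.
Proof.
  intros M H. induction L as [|[m c] L IH]; intros w0 V.
  - destruct (H w0 V) as [i Hi]. exists i. intros w _ E. replace w with w0; [exact Hi|].
    extensionality m; extensionality c. symmetry. apply E. auto.
  - destruct (bounded_choice (fun v i => v < q -> forall w, valid q w ->
      (forall m' c', ~ In (m', c') L -> w m' c' = upd w0 m c v m' c') -> Q w i) q) as [i Hi].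
    + intros v i j K Lij Lv w Vw E. apply (M w i); [|exact Lij]. apply K; assumption.
    + intros v Lv. destruct (IH (upd w0 m c v)) as [i Hi]; [apply upd_valid; assumption|].
      exists i. intros _ w Vw E. apply Hi; assumption.
    + exists i. intros w Vw E. apply (Hi (w m c)); [apply Vw|apply Vw|exact Vw|].
      intros m' c' NI. destruct (classic (m' = m /\ c' = c)) as [[-> ->]|NE].
      * rewrite upd_eq. reflexivity.
      * rewrite upd_neq by tauto. apply E. intros [E'|I']; [|contradiction].
        injection E' as -> ->. apply NE; auto.
Qed.

Lemma uniform_secrets q dm dc (Q : W -> nat -> Prop) : 0 < q ->
  (forall w i j, Q w i -> i <= j -> Q w j) ->
  (forall w w' i, (forall m c, m <= dm -> c <= dc -> w m c = w' m c) -> Q w i -> Q w' i) ->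
  (forall w, valid q w -> exists i, Q w i) -> exists i, forall w, valid q w -> Q w i.
Proof.
  intros Hq M Loc H.
  destruct (uniform_coords q Q M H (list_prod (seq 0 (S dm)) (seq 0 (S dc))) (fun _ _ => 0))
    as [i Hi].
  { intros ? ?; lia. }
  exists i. intros w Vw.
  (* Truncation leaves only finitely many entries free to vary. *)
  apply (Loc (fun m c => if (m <=? dm) && (c <=? dc) then w m c else 0)).
  - intros m c Lm Lc. rewrite (proj2 (Nat.leb_le _ _) Lm), (proj2 (Nat.leb_le _ _) Lc). reflexivity.
  - apply Hi.
    + intros m c. destruct ((m <=? dm) && (c <=? dc)); [apply Vw|lia].
    + intros m c NI. destruct (Nat.leb_spec m dm), (Nat.leb_spec c dc); simpl; try reflexivity.
      elim NI. apply in_prod; apply in_seq; lia.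
Qed.

(** * Non-definability *)

(** With a retract as parameter both halves are instances: the identity for the first, the coding
    for the second. A term for [Yc tau] yields, with the same recursors, one that acts as a fixed
    point operator on the retract. *)
Theorem Y_retract_not_denotable l k0 tau
  (e : D (Arr (Arr N (rho (S (S k0)) (S l))) tau))
  (r : D (Arr tau (Arr N (rho (S (S k0)) (S l))))) :
  1 <= l ->
  (forall P G, Dfn P G _ (fun _ _ => e)) -> (forall P G, Dfn P G _ (fun _ _ => r)) ->
  (forall f, r (e f) = f) ->
  ~ Y_denotable_in (in_PCFO_kl (S (S k0)) l) tau.
Proof.
  intros Hl He Hr Hre [M [OK [HM Heq]]].
  set (q := S l). set (sigma := Arr N (rho (S (S k0)) q)).
  set (P := fun s => sublevel_le s (S (S k0)) l).
  destruct (den_exists _ _ _ HM) as [f Hf].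
  (* By [Hre], [r (tr h F)] is [h (r F)]: a step in [tau] becomes a step of [h]. *)
  pose (tr := fun (h : D (Arr sigma sigma)) (F : D tau) => e (h (r F))).
  assert (Htr : forall G h, Dfn P G (Arr sigma sigma) h ->
    Dfn P G (Arr tau tau) (fun i g => tr (h i g))).
  { intros G h Hh. apply (Dfn_lam P G tau tau (fun i g => tr (h i g))). intros G' p F Wp HF.
    apply (Dfn_app P G' sigma tau (fun _ _ => e) (fun i g => h i (p g) (r (F i g))) (He P G')).
    apply (Dfn_app P G' sigma sigma (fun i g => h i (p g)) (fun i g => r (F i g)));
      [apply (Wp _ h Hh)|].
    apply (Dfn_app P G' tau sigma (fun _ _ => r) F (Hr P G') HF). }
  assert (HM' : Dfn P [] (Arr (Arr sigma sigma) sigma) (fun i _ h => r (f i tt (tr h)))).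
  { apply Dfn_lam. intros G' p h Wp Hh.
    apply (Dfn_app P G' tau sigma (fun _ _ => r) (fun i g => f i tt (tr (h i g))) (Hr P G')).
    apply (Dfn_app P G' (Arr tau tau) tau (fun i _ => f i tt) (fun i g => tr (h i g)));
      [|apply Htr, Hh].
    apply (Wp _ (fun i _ => f i tt)). exists M. split; [exact OK|].
    replace (fun (i : nat) (_ : env []) => f i tt) with f; [exact Hf|].
    extensionality i; extensionality g. destruct g. reflexivity. }
  destruct HM' as [M' [OK' Hf']].
  destruct (closed_Pt l k0 Hl M' _ Hf' OK') as [d chain_Pt]. fold q in chain_Pt.
  (* The experiment to which [M] and [Yc tau] are submitted: the fixed point of the chain, queried
     at level [0]. *)
  pose (R := fun (w : W) (m : D (Arr (Arr tau tau) tau)) =>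
    appn q (rho (S k0) q) (r (m (tr (chain q k0 d w))) (Some 0)) (fun _ => bot _)).
  assert (HR : forall w, Dfn P [] (Arr (Arr (Arr tau tau) tau) N) (fun _ _ => R w)).
  { intros w. apply Dfn_lam. intros G' p m Wp Hm.
    apply (Dfn_appn P (rho (S k0) q) q G' (fun i g => r (m i g (tr (chain q k0 d w))) (Some 0))
      (fun _ _ _ => bot _)); [|intros; apply Dfn_bot].
    apply (Dfn_app P G' N (rho (S (S k0)) q) (fun i g => r (m i g (tr (chain q k0 d w))))
      (fun _ _ => Some 0)); [|apply Dfn_some].
    apply (Dfn_app P G' tau sigma (fun _ _ => r) (fun i g => m i g (tr (chain q k0 d w))) (Hr P G')).
    apply (Dfn_app P G' (Arr tau tau) tau m (fun _ _ => tr (chain q k0 d w)) Hm).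
    apply (Htr G' (fun _ _ => chain q k0 d w)), Dfn_chain. }
  assert (E : forall w, valid q w -> exists i, forall j, i <= j -> R w (f j tt) = Some (w 0 0)).
  { intros w Vw. destruct (HR w) as [tR [_ HtR]].
    assert (S1 : steps (App tR (Yc tau)) (Num (w 0 0))).
    (* The levels [0] to [d] take [S d] iterates. *)
    { apply (den_steps _ _ _ (S d) (den_App _ _ _ _ _ _ _ HtR (den_Y [] tau))).
      apply (chain_value q k0 d w (fun i => r (Nat.iter i (tr (chain q k0 d w)) (bot tau)))); try lia;
        [exact Vw|]. intros j. apply Hre. }
    assert (S2 : steps (App tR M) (Num (w 0 0))).
    { assert (Bt : forall v, subst 0 v (App tR (Var 0)) = App tR v).
      { intros v. simpl. rewrite (bnd_subst tR 0); [reflexivity| |lia].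
        apply (den_bnd _ _ _ _ HtR). }
      rewrite <- Bt. apply Heq; [|rewrite Bt; exact S1].
      apply (T_App _ _ _ (Arr (Arr tau tau) tau)); [|constructor; reflexivity].
      pose proof (den_has_type _ _ _ _ (den_lift tR [] (Arr (Arr tau tau) tau) [] _ _ HtR)) as K.
      simpl in K. rewrite (bnd_lift tR 0) in K; [exact K| |lia]. apply (den_bnd _ _ _ _ HtR). }
    assert (HA := den_App _ _ _ _ _ _ _ HtR Hf).
    destruct (steps_den _ _ _ S2 HA) as [i Hi].
    exists i. intros j Lj. apply (den_mono_closed _ _ _ _ _ HA Hi Lj). }
  (* So far the index depends on [w], whereas [chain_Pt] compares different tables at a single
     index. *)
  destruct (uniform_secrets q d (S (S k0)) (fun w i => forall j, i <= j -> R w (f j tt) = Some (w 0 0)))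
    as [i Hi]; [unfold q; lia| | |exact E|].
  - intros w i j K L j' L'. apply K. lia.
  - intros w w' i A K j L. rewrite <- (A 0 0), <- K with (j := j) by lia.
    unfold R. rewrite (chain_local q k0 d w w' A). reflexivity.
  - destruct (Pt_not_secret l Hl _ (chain_Pt i)) as [w [Vw NE]]. apply NE. apply (Hi w Vw i (le_n _)).
Qed.

Lemma wa_arrn a b : fst (wa (arrn b a N)) = b /\ snd (wa (arrn b a N)) <= width a.
Proof.
  induction b as [|b [IH1 IH2]]; cbn [arrn wa fst snd]; [split; lia|].
  split; [lia|]. unfold width in *. lia.
Qed.

Lemma width_rho i b : width (rho i b) <= b.
Proof.
  induction i as [|i IH]; [apply Nat.le_0_l|]. cbn [rho].
  destruct (wa_arrn (rho i b) b) as [H1 H2]. unfold width in *. lia.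
Qed.

(** The extra argument of type [N] costs one unit of width and does not raise the level above
    [k]. *)
Lemma sublevel_sigma k b : 1 <= k -> sublevel_le (Arr N (rho k b)) k (S b).
Proof.
  intros Hk. pose proof (lv_rho k b). pose proof (width_rho k b) as Hw.
  destruct (Nat.lt_ge_cases (lv (Arr N (rho k b))) k) as [L|L]; [right; left; exact L|].
  right; right. unfold width in *. cbn [lv wa fst snd] in *. split; lia.
Qed.

(** A term contains finitely many recursors, so their widths are bounded. *)
Lemma Y_ok_width k t : Y_ok (fun s => lv s <= k) t ->
  exists l, 1 <= l /\ Y_ok (fun s => sublevel_le s k l) t.
Proof.
  assert (M : forall l l' t, l <= l' ->
    Y_ok (fun s => sublevel_le s k l) t -> Y_ok (fun s => sublevel_le s k l') t).
  { intros l l' t' L. apply Y_ok_impl. intros s [H|[H|H]]; unfold sublevel_le; auto.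
    right; right. lia. }
  induction t; simpl; intros H; try (exists 1; auto; fail).
  - apply IHt, H.
  - destruct H as [H1 H2]. destruct (IHt1 H1) as [l1 [L1 O1]], (IHt2 H2) as [l2 [L2 O2]].
    exists (Nat.max l1 l2). split; [lia|]. split.
    + apply (M l1); [lia|exact O1].
    + apply (M l2); [lia|exact O2].
  (* The successor ensures [1 <= l]. *)
  - exists (S (width t)). split; [lia|]. right.
    destruct (Nat.lt_ge_cases (lv t) k); [left; assumption|right; lia].
Qed.

Theorem theorem6p8 :
  (forall k l : nat, 2 <= k -> 1 <= l ->
     Y_denotable_in (in_PCF_kl k (l + 2)) (Arr N (rho k (l + 1))) /\
     ~ Y_denotable_in (in_PCFO_kl k l) (Arr N (rho k (l + 1)))) /\
  (forall k : nat, 2 <= k ->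
     ~ Y_denotable_in (in_PCFO_k k) (pure (k + 1))).
Proof.
  split.
  - intros k l Hk Hl. split.
    + exists (Yc (Arr N (rho k (l + 1)))). split; [split; [exact I|]|split].
      * replace (l + 2) with (S (l + 1)) by lia. apply sublevel_sigma. lia.
      * constructor.
      * intros C _ n. reflexivity.
    + destruct k as [|[|k0]]; [lia|lia|]. replace (l + 1) with (S l) by lia.
      apply (Y_retract_not_denotable l k0 (Arr N (rho (S (S k0)) (S l))) (fun f => f) (fun f => f) Hl); [| |reflexivity];
        intros P G; apply Dfn_lam; auto.
  - intros k Hk [M [OK HM]]. destruct k as [|[|k0]]; [lia|lia|].
    destruct (Y_ok_width _ _ OK) as [l [Hl OK']].
    apply (Y_retract_not_denotable l k0 (pure (S (S (S k0)))) (enc (S l) (S k0)) (ret (S l) (S k0)) Hl).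
    + intros P G. apply Dfn_enc.
    + intros P G. apply Dfn_ret.
    + apply ret_enc.
    + exists M. split; [exact OK'|]. rewrite Nat.add_1_r in HM. exact HM.
Qed.
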